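(* For $\beta\geq 0$ let $\alpha_\beta$ and $\varpi_\beta$ denote the Poincaré and Log-Sobolev constants of the probability measure $$\mu_\beta(dx)\propto e^{\beta\cos x}\mathbf{1}_{[-\pi,\pi]}(x)\,dx.$$ Then there are constants $0<c_1<c_2$ independent of $\beta$ such that $$c_1\leq\varpi_\beta\leq c_2\quad\text{for all }\beta\geq 0.$$ Similarly, there exists a constant $c_3>0$ independent of $\beta$ such that $$\alpha_\beta\leq\frac{c_3}{\beta}\quad\text{for all }\beta>0.$$
   Context: Let $U=(-\pi,\pi)$ and let $H^1(U,\mu_\beta)$ be the space of weakly differentiable $f:U\to\mathbb{R}$ with $f,f'\in L^2(U,\mu_\beta)$ (no periodicity is imposed). The Poincaré constant $\alpha_\beta$ is the smallest constant such that $\int_U f^2\,d\mu_\beta-(\int_U f\,d\mu_\beta)^2\leq\alpha_\beta\int_U(f')^2\,d\mu_\beta$ for all $f\in H^1(U,\mu_\beta)$. The Log-Sobolev constant $\varpi_\beta$ is the smallest constant such that $$\operatorname{ent}_{\mu_\beta}(f^2):=\int_U f^2\log\left(\frac{f^2}{\|f\|_{L^2(U,\mu_\beta)}^2}\right)d\mu_\beta\leq\varpi_\beta\int_U(f')^2\,d\mu_\beta\quad\text{for all }f\in H^1(U,\mu_\beta),$$ with the convention $\operatorname{ent}_{\mu_\beta}(0)=0$. *)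

(* Defs.v *)
From HB Require Import structures.
From mathcomp Require Import all_boot all_order all_algebra.
From mathcomp Require Import all_classical all_reals all_analysis.
From mathcomp Require Import measurable_realfun.

Set Implicit Arguments.
Unset Strict Implicit.
Unset Printing Implicit Defensive.

Import Order.TTheory GRing.Theory Num.Theory.
Import numFieldTopology.Exports numFieldNormedType.Exports.

Local Open Scope classical_set_scope.
Local Open Scope ring_scope.

(* A function on U is represented by a function R -> R; every notion below
   only depends on its values on U. *)
Definition U (R : realType) : set R := `]- pi, pi[.
Arguments U {R}.

Definition gibbs_weight (R : realType) (beta x : R) : R :=
  expR (beta * cos x) * \1_(`[- pi, pi] : set R) x.

Definition gibbs_mass (R : realType) (beta : R) : R :=
  \int[lebesgue_measure]_x gibbs_weight beta x.

Definition gibbs_pdf (R : realType) (beta x : R) : R :=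
  gibbs_weight beta x / gibbs_mass beta.

Definition gibbs (R : realType) (beta : R) : set R -> \bar R :=
  fun A => (\int[lebesgue_measure]_(x in A) (gibbs_pdf beta x)%:E)%E.

Section gibbs_probability.
Context (R : realType) (beta : R).
Local Notation leb := (@lebesgue_measure R).

Lemma continuous_gibbs_exp : continuous (fun x : R => expR (beta * cos x)).
Proof.
move=> x; apply: (continuous_comp (f := fun y : R => beta * cos y)).
  by apply: cvgMl_tmp; exact: continuous_cos.
exact: continuous_expR.
Qed.

Lemma measurable_gibbs_exp :
  measurable_fun setT (fun x : R => expR (beta * cos x)).
Proof. by apply: continuous_measurable_fun; exact: continuous_gibbs_exp. Qed.

Lemma gibbs_weight_ge0 x : 0 <= gibbs_weight beta x.
Proof. by rewrite mulr_ge0 ?expR_ge0// indicE ler0n. Qed.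

Lemma measurable_gibbs_weight : measurable_fun setT (gibbs_weight beta).
Proof.
apply: measurable_funM; last exact: measurable_indic.
exact: measurable_gibbs_exp.
Qed.

Lemma gibbs_weight_restrict :
  (fun x => (gibbs_weight beta x)%:E) =
  (fun x => (expR (beta * cos x))%:E) \_ (`[- pi, pi] : set R).
Proof.
apply/funext => x; rewrite patchE /gibbs_weight indicE.
by case: (x \in _); rewrite ?mulr1// mulr0.
Qed.

Lemma integrable_gibbs_weight :
  leb.-integrable setT (fun x => (gibbs_weight beta x)%:E).
Proof.
rewrite gibbs_weight_restrict; apply/integrable_restrict => //=.
rewrite setTI; apply: continuous_compact_integrable.
  exact: segment_compact.
exact/continuous_subspaceT/continuous_gibbs_exp.
Qed.

Lemma gibbs_massE :
  (gibbs_mass beta)%:E = (\int[leb]_x (gibbs_weight beta x)%:E)%E.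
Proof.
rewrite /gibbs_mass /Rintegral fineK//.
exact: (integrable_fin_num _ integrable_gibbs_weight).
Qed.

Lemma gibbs_mass_gt0 : 0 < gibbs_mass beta.
Proof.
rewrite -lte_fin gibbs_massE gibbs_weight_restrict -integral_mkcond.
have pi0 : - pi < pi :> R by rewrite gtrN ?pi_gt0.
have lb : (0 < \int[leb]_(x in `[(- pi)%R, pi]) (expR (- `|beta|))%:E)%E.
  rewrite integral_cst//= lebesgue_measure_itv/= lte_fin pi0.
  by rewrite -EFinB -EFinM lte_fin mulr_gt0 ?expR_gt0// subr_gt0.
apply: (lt_le_trans lb); apply: ge0_le_integral.
- exact: measurable_itv.
- by move=> x _; rewrite lee_fin expR_ge0.
- exact: measurable_cst.
- apply/measurable_EFinP; apply: measurable_funTS.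
  exact: measurable_gibbs_exp.
- move=> x _; rewrite lee_fin ler_expR lerNl.
  apply: (le_trans (ler_norm _)); rewrite normrN normrM ler_piMr//.
  by rewrite ler_norml cos_geN1 cos_le1.
Qed.

Lemma gibbs_pdf_ge0 x : 0 <= gibbs_pdf beta x.
Proof. by rewrite divr_ge0 ?gibbs_weight_ge0 ?ltW ?gibbs_mass_gt0. Qed.

Lemma measurable_gibbs_pdf : measurable_fun setT (gibbs_pdf beta).
Proof. by apply: measurable_funM => //; exact: measurable_gibbs_weight. Qed.

Let gibbs0 : gibbs beta set0 = 0%E.
Proof. by rewrite /gibbs integral_set0. Qed.

Let gibbs_ge0 A : (0 <= gibbs beta A)%E.
Proof. by apply: integral_ge0 => x _; rewrite lee_fin gibbs_pdf_ge0. Qed.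

Let gibbs_sigma_additive : semi_sigma_additive (gibbs beta).
Proof.
move=> /= F mF tF mUF; rewrite /gibbs; apply: cvg_toP.
  apply: ereal_nondecreasing_is_cvgn => m n mn.
  apply: lee_sum_nneg_natr => // k _ _; apply: integral_ge0 => /= x Fkx.
  by rewrite lee_fin gibbs_pdf_ge0.
rewrite ge0_integral_bigcup//=.
- apply/measurable_funTS/measurableT_comp => //.
  exact: measurable_gibbs_pdf.
- by move=> x _; rewrite lee_fin gibbs_pdf_ge0.
Qed.

HB.instance Definition _ := isMeasure.Build _ _ _
  (gibbs beta) gibbs0 gibbs_ge0 gibbs_sigma_additive.

Let gibbs_setT : gibbs beta [set: R] = 1%E.
Proof.
rewrite /gibbs /gibbs_pdf.
under eq_integral do rewrite mulrC EFinM.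
rewrite ge0_integralZl//=; last 3 first.
- by apply/measurable_EFinP; exact: measurable_gibbs_weight.
- by move=> x _; rewrite lee_fin gibbs_weight_ge0.
- by rewrite lee_fin invr_ge0 ltW ?gibbs_mass_gt0.
by rewrite -gibbs_massE -EFinM mulVf// gt_eqF// gibbs_mass_gt0.
Qed.

HB.instance Definition _ :=
  @Measure_isProbability.Build _ _ R (gibbs beta) gibbs_setT.

End gibbs_probability.

(* The test functions C_c^oo(U). *)
Definition test_function (R : realType) (phi : R -> R) : Prop :=
  [/\ forall (n : nat) (x : R), derivable (derive1n n phi) x 1,
      compact (closure [set x | phi x != 0]) &
      closure [set x | phi x != 0] `<=` U].

Definition weak_derivative (R : realType) (f g : R -> R) : Prop :=
  [/\ locally_integrable U f, locally_integrable U g &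
      forall phi : R -> R, test_function phi ->
        \int[lebesgue_measure]_(x in U) (f x * derive1 phi x) =
        - \int[lebesgue_measure]_(x in U) (g x * phi x)].

(* f \in H^1(U, mu_beta), with weak derivative f' = g. *)
Definition H1 (R : realType) (beta : R) (f g : R -> R) : Prop :=
  [/\ weak_derivative f g,
      f \_ U \in Lfun (gibbs beta) 2%:E &
      g \_ U \in Lfun (gibbs beta) 2%:E].

Definition sqnorm (R : realType) (beta : R) (f : R -> R) : R :=
  \int[gibbs beta]_(x in U) (f x ^+ 2).

Local Open Scope ereal_scope.

Definition energy (R : realType) (beta : R) (g : R -> R) : \bar R :=
  \int[gibbs beta]_(x in U) (g x ^+ 2)%:E.

Definition var (R : realType) (beta : R) (f : R -> R) : \bar R :=
  \int[gibbs beta]_(x in U) (f x ^+ 2)%:E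
  - (\int[gibbs beta]_(x in U) (f x)%:E) ^+ 2.

(* Since 0^-1 = 0 and ln 0 = 0, the integrand vanishes where f does, and
   ent 0 = 0. *)
Definition ent (R : realType) (beta : R) (f : R -> R) : \bar R :=
  \int[gibbs beta]_(x in U)
    (f x ^+ 2 * ln (f x ^+ 2 / sqnorm beta f))%:E.

(* The sets of admissible constants are closed, so each infimum below is the
   smallest admissible constant, or +oo if there is none. *)
Definition poincare_const (R : realType) (beta : R) : \bar R :=
  ereal_inf [set C%:E | C in [set C : R |
    forall f g, H1 beta f g -> var beta f <= C%:E * energy beta g]].

Definition log_sobolev_const (R : realType) (beta : R) : \bar R :=
  ereal_inf [set C%:E | C in [set C : R |
    forall f g, H1 beta f g -> ent beta f <= C%:E * energy beta g]].

(* Main.v *)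
Require Import Defs.
From mathcomp Require Import all_boot all_order all_algebra.
From mathcomp Require Import all_classical all_reals all_analysis.
From mathcomp Require Import measurable_realfun.
From mathcomp Require Import ring lra.
Set Implicit Arguments.
Unset Strict Implicit.
Unset Printing Implicit Defensive.
Import Order.TTheory GRing.Theory Num.Theory.
Import numFieldTopology.Exports numFieldNormedType.Exports.
Local Open Scope classical_set_scope.
Local Open Scope ring_scope.

(** Both upper bounds come from one weighted Hardy inequality.  A function [f]
    of [H1] is almost everywhere [a + \int_0^x g], where [g] is its weak
    derivative ([H1_travel]).  So [|f - a| <= H] almost everywhere, where [H x],
    called [travel g x] below, is the integral of [|g|] over the segment joining
    [0] and [x].  As [x] moves away from [0], the square [H^2] has derivative
    [2 |g| H]; hence, by Tonelli, the integral of [H^2 v] is at most that of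
    [2 |g(s)| H(s)] times the tail of [v] at [s], the integral of [v] over the
    points [x] beyond [s] as seen from [0] ([hardy_tonelli]).  When each such
    tail is at most [C q(s) p(s)], with [p] the density of the measure and [q] a
    weight, the inequality of arithmetic and geometric means leaves a multiple
    of the energy and a multiple of the integral of [H^2 q^2 p]
    ([hardy_step]); for [v = q^2 p] the latter is absorbed by the left side
    ([hardy_absorb]).

    The constants do not depend on [beta] because the tails are Gaussian: on
    the whole of [[-pi, pi]], including the region where the potential
    [- beta cos] is concave, [cos s - cos x >= (x - s)^2 / 8] whenever [s] lies
    between [0] and [x] ([cos_gap]).  With [q = sqrt beta] this gives the
    Poincare inequality with a constant of order [1 / beta].  With
    [q x = 1 + sqrt beta |x|] it bounds the integral of [H^2 psi p] for every
    [psi >= 0] with [\int expR psi d mu <= 2] ([gibbs_hardy_entropy]).  The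
    choice [psi = ln 2] bounds [\int (f - a)^2 d mu], and
    [psi = ln (1 + (f - a)^2 / n)] bounds
    [\int (f - a)^2 ln (1 + (f - a)^2 / n) d mu], an entropy of [f - a]; a
    pointwise inequality in the spirit of the lemma of Rothaus passes to [f]
    ([ent_pointwise]).

    For the lower bound when [beta > 0], let [f x = expR (- beta * cos x)].
    Then [f^2 mu] is the measure [mu] rotated by [pi], and one integration by
    parts gives an entropy equal to twice the energy ([ent_expcos]).  At
    [beta = 0] this [f] is constant, and an affine function serves instead
    ([ent_affine]). *)

(** * Integrals against the Gibbs measure *)

Section gibbs_integral.
Context {R : realType} (beta : R).
Local Notation leb := (@lebesgue_measure R).
Local Notation mu := (gibbs beta).
Local Notation p := (gibbs_pdf beta).
Local Open Scope ereal_scope.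

Lemma integrable_gibbs_pdf : leb.-integrable setT (EFin \o p).
Proof.
have -> : EFin \o p = (fun x => (gibbs_mass beta)^-1%:E * (gibbs_weight beta x)%:E).
  by apply/funext => x; rewrite /= /gibbs_pdf EFinM muleC.
by apply: integrableZl => //; exact: integrable_gibbs_weight.
Qed.

Let integral_gibbs_indic (E : set R) : measurable E ->
  \int[mu]_x (\1_E x)%:E = \int[leb]_x (\1_E x * p x)%:E.
Proof.
move=> mE; rewrite integral_indic//= setIT /gibbs integral_mkcond/=.
apply: eq_integral => x _; rewrite patchE indicE.
by case: ifPn => _; rewrite ?mul1r// mul0r.
Qed.

Import HBNNSimple.

Let integral_gibbs_nnsfun (f : {nnsfun R >-> R}) :
  \int[mu]_x (f x)%:E = \int[leb]_x ((f x)%:E * (p x)%:E).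
Proof.
have mf r : measurable (f @^-1` [set r]) by [].
under [LHS]eq_integral do rewrite fimfunE -fsumEFin//.
rewrite [LHS]ge0_integral_fsum//; last 2 first.
- by move=> r; exact/measurable_EFinP/measurableT_comp.
- by move=> n x _; rewrite EFinM nnfun_muleindic_ge0.
under [RHS]eq_integral.
  move=> x xD; rewrite fimfunE -fsumEFin// ge0_mule_fsuml; last first.
    by move=> r; rewrite EFinM nnfun_muleindic_ge0.
  over.
rewrite [RHS]ge0_integral_fsum//; last 2 first.
- move=> r; apply: emeasurable_funM.
    apply/measurable_EFinP; apply: measurable_funM => //.
    exact: (measurable_indic (mf r)).
  by apply/measurable_EFinP; exact: measurable_gibbs_pdf.
- move=> n x _; apply: mule_ge0; last by rewrite lee_fin gibbs_pdf_ge0.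
  by rewrite EFinM nnfun_muleindic_ge0.
apply: eq_fsbigr => r; rewrite inE => -[y _ <-].
have fy0 : (0 <= f y)%R by [].
under eq_integral do rewrite EFinM.
rewrite ge0_integralZl//; last first.
  by apply/measurable_EFinP; exact: measurable_indic.
rewrite integral_gibbs_indic//.
rewrite -ge0_integralZl//.
- by apply: eq_integral => x _; rewrite -!EFinM mulrA.
- apply/measurable_EFinP; apply: measurable_funM; last exact: measurable_gibbs_pdf.
  exact: (measurable_indic (mf _)).
- by move=> x _; rewrite lee_fin mulr_ge0// ?gibbs_pdf_ge0// indicE ler0n.
Qed.

(** The Gibbs measure and the Lebesgue measure live on two distinct copies of
    the Borel sigma-algebra, so Radon-Nikodym theory does not apply directly;
    the change of density is derived from simple functions by monotone
    convergence. *)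
Lemma ge0_integral_gibbsT (F : R -> \bar R) : measurable_fun setT F ->
  (forall x, 0 <= F x) ->
  \int[mu]_x F x = \int[leb]_x (F x * (p x)%:E).
Proof.
move=> mF F0.
have mp : measurable_fun setT (EFin \o p).
  by apply/measurable_EFinP; exact: measurable_gibbs_pdf.
pose f_ := nnsfun_approx measurableT mF.
transitivity (lim (\int[mu]_x (f_ n x)%:E @[n --> \oo])).
  rewrite -monotone_convergence//=.
  - apply: eq_integral => ? /[!inE] xD; apply/esym/cvg_lim => //=.
    exact: cvg_nnsfun_approx.
  - by move=> n; exact/measurable_EFinP/measurable_funTS.
  - by move=> n ? _; rewrite lee_fin.
  - by move=> ? _ ? ? mn; rewrite lee_fin; exact/lefP/nd_nnsfun_approx.
under eq_fun do rewrite integral_gibbs_nnsfun.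
rewrite -monotone_convergence//=.
- apply: eq_integral => x /[!inE] xD; apply/cvg_lim => //=.
  by apply: cvgeZr => //; exact: cvg_nnsfun_approx.
- move=> n; apply: emeasurable_funM => //.
  have mfn : measurable_fun setT (f_ n) by exact: measurable_funTS.
  by apply/measurable_EFinP; exact: mfn.
- by move=> n x _; rewrite mule_ge0 ?lee_fin ?gibbs_pdf_ge0.
- move=> x _ m n mn; rewrite -!EFinM lee_fin ler_wpM2r ?gibbs_pdf_ge0//.
  have h : ((f_ m : R -> R) <= (f_ n : R -> R))%O by exact: nd_nnsfun_approx.
  by move/lefP : h; exact.
Qed.

Lemma ge0_integral_gibbs (D : set R) (F : R -> \bar R) : measurable D ->
  measurable_fun D F -> (forall x, D x -> 0 <= F x) ->
  \int[mu]_(x in D) F x = \int[leb]_(x in D) (F x * (p x)%:E).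
Proof.
move=> mD mF F0; rewrite integral_mkcond ge0_integral_gibbsT.
- rewrite [RHS]integral_mkcond; apply: eq_integral => x _.
  by rewrite !patchE; case: ifPn => //; rewrite mul0e.
- by move/(measurable_restrictT F mD) : mF.
- by move=> x; rewrite patchE; case: ifPn => // /set_mem /F0.
Qed.

Lemma integral_gibbs (D : set R) (F : R -> \bar R) : measurable D ->
  measurable_fun D F ->
  \int[mu]_(x in D) F x = \int[leb]_(x in D) (F x * (p x)%:E).
Proof.
move=> mD mF; rewrite integralE [RHS]integralE.
rewrite ge0_integral_gibbs//; last exact: measurable_funepos.
rewrite ge0_integral_gibbs//; last exact: measurable_funeneg.
congr (_ - _); apply: eq_integral => x _.
  by rewrite !funeposE maxeMl ?lee_fin ?gibbs_pdf_ge0// mul0e.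
by rewrite !funenegE maxeMl ?lee_fin ?gibbs_pdf_ge0// mul0e mulNe.
Qed.

Lemma gibbs_pdfE (x : R) : (- pi <= x <= pi)%R ->
  p x = (expR (beta * cos x) / gibbs_mass beta)%R.
Proof.
move=> xpi; rewrite /gibbs_pdf /gibbs_weight indicE mem_set ?mulr1//=.
Qed.

Lemma gibbs_pdf_out (x : R) : ~~ (- pi <= x <= pi)%R -> p x = 0%R.
Proof.
move=> xpi; rewrite /gibbs_pdf /gibbs_weight indicE memNset ?mulr0 ?mul0r//=.
by rewrite in_itv/=; exact/negP.
Qed.

Lemma measurable_U : measurable (@U R).
Proof. exact: measurable_itv. Qed.

Lemma integral_gibbs_itv (F : R -> R) : measurable_fun setT F ->
  \int[mu]_(x in U) (F x)%:E =
  \int[leb]_(x in `[(- pi)%R, pi]) (F x * (expR (beta * cos x) / gibbs_mass beta))%:E.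
Proof.
move=> mF; rewrite integral_gibbs; last 2 first.
- exact: measurable_U.
- by apply/measurable_EFinP; exact: measurable_funTS.
rewrite (@integral_itv_bndoo R (- pi)%R pi _ true false); last first.
  apply/measurable_EFinP; apply: measurable_funTS; apply: measurable_funM => //.
  by apply: measurable_funM => //; exact: measurable_gibbs_exp.
apply: eq_integral => x /set_mem; rewrite /U /= in_itv/= => /andP[x1 x2].
by rewrite gibbs_pdfE ?(ltW x1) ?(ltW x2)// EFinM.
Qed.

End gibbs_integral.

(** * Smooth bumps and ramps *)

(** This says that [f] is [n.+1] times differentiable.  The recursion goes
    through [derive1 f], so that sums and products are handled by induction on
    [n] without a Leibniz formula. *)
Fixpoint nderivable (R : realType) (n : nat) (f : R -> R) : Prop :=
  (forall x, derivable f x 1) /\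
  if n is m.+1 then nderivable m (derive1 f) else True.

Section smooth.
Context {R : realType}.
Implicit Types f g : R -> R.

Lemma nderivable_derivable n f x : nderivable n f -> derivable f x 1.
Proof. by case: n => [|n] []. Qed.

Lemma nderivableW n f : nderivable n.+1 f -> nderivable n f.
Proof.
elim: n f => [|n IH] f [df dn]; first by split.
by split => //; apply: IH.
Qed.

Lemma nderivable_derive1n n f x : nderivable n f -> derivable (derive1n n f) x 1.
Proof.
elim: n f => [|n IH] f; first by case.
by case=> _ /IH; rewrite derive1Sn.
Qed.

Lemma nderivableD n f g : nderivable n f -> nderivable n g -> nderivable n (fun x => f x + g x).
Proof.
elim: n f g => [|n IH] f g [df cf] [dg cg].
  by split => // x; apply: derivableD.
split; first by move=> x; apply: derivableD.
have -> : derive1 (fun x => f x + g x) = (fun x => derive1 f x + derive1 g x).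
  apply/funext => x; rewrite !derive1E deriveD//.
exact: IH.
Qed.

Lemma nderivableM n f g : nderivable n f -> nderivable n g -> nderivable n (fun x => f x * g x).
Proof.
elim: n f g => [|n IH] f g /[dup] cf' [df cf] /[dup] cg' [dg cg].
  by split => // x; apply: derivableM.
split; first by move=> x; apply: derivableM.
have -> : derive1 (fun x => f x * g x) =
    (fun x => f x * derive1 g x + g x * derive1 f x).
  apply/funext => x; rewrite !derive1E deriveM//.
by apply: nderivableD; apply: IH => //; exact: nderivableW.
Qed.

Lemma nderivable_cst n (c : R) : nderivable n (fun=> c).
Proof.
elim: n c => [|n IH] c; (split; first by move=> x; exact: derivable_cst) => //.
have -> : derive1 (fun=> c : R) = (fun=> 0).
  by apply/funext => x; rewrite derive1E derive_cst.
exact: IH.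
Qed.

Lemma nderivable_affine n f (a b : R) : nderivable n f -> nderivable n (fun x => f (a * x + b)).
Proof.
have H g : (forall x, derivable g x 1) ->
    forall x : R, is_derive x (1 : R) (fun x : R => g (a * x + b)) (a * derive1 g (a * x + b)).
  move=> dg x.
  have d1 : is_derive x (1 : R) (fun x : R => a * x + b) a.
    have : is_derive x (1 : R) (a \*: (id : R -> R^o) + cst b) (a *: 1 + 0) by exact: is_deriveD.
    by rewrite addr0 scaler1.
  have d2 : is_derive (a * x + b) (1 : R) g (derive1 g (a * x + b)).
    by rewrite derive1E; apply: derivableP.
  by have := @is_derive1_comp _ g (fun x : R => a * x + b) _ _ _ d2 d1; rewrite mulrC.
elim: n f => [|n IH] f [df cf].
  by split => // x; have [] := H f df x.
split; first by move=> x; have [] := H f df x.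
have -> : derive1 (fun x => f (a * x + b)) =
    (fun x => (fun=> a) x * (fun x => derive1 f (a * x + b)) x).
  apply/funext => x; rewrite derive1E; exact: (@derive_val _ _ _ _ _ _ _ (H f df x)).
by apply: nderivableM; [exact: nderivable_cst|exact: IH].
Qed.

(** The family [t^-k expR (-1/t)] is stable under differentiation up to linear
    combinations ([flat_derive]), which makes the smoothness of each member a
    plain induction. *)
Definition flat (k : nat) (t : R) : R :=
  if 0 < t then t ^- k * expR (- t^-1) else 0.

Lemma flat_ge0 k t : 0 <= flat k t.
Proof.
rewrite /flat; case: ifP => // t0.
by rewrite mulr_ge0 ?expR_ge0// invr_ge0 exprn_ge0// ltW.
Qed.

(** The exponential beats every power: [expR (1/t)] is at least its Taylor term
    of order [k+2].  The bound by [t^2] gives the derivative [0] at the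
    origin. *)
Lemma flat_le k (t : R) : flat k t <= k.+2`!%:R * t ^+ 2.
Proof.
rewrite /flat; case: ifPn => [t0|_]; last by rewrite mulr_ge0// sqr_ge0.
have h : t ^- k.+2 / k.+2`!%:R <= expR t^-1.
  have ti0 : 0 <= t^-1 by rewrite invr_ge0 ltW.
  by rewrite -exprVn; apply: le_trans (expR_ge1Dxn k.+1 ti0); rewrite lerDr.
have f0 : 0 < (k.+2)`!%:R :> R by rewrite ltr0n fact_gt0.
rewrite expRN ler_pdivrMr ?expR_gt0//.
move: h; rewrite ler_pdivrMr// => h.
have -> : t ^- k = t ^+ 2 * t ^- k.+2.
  by rewrite -[in RHS](addn2 k) exprD invfM [X in _ * X]mulrC mulrA mulfV ?mul1r// expf_neq0// gt_eqF.
rewrite [leRHS](_ : _ = t ^+ 2 * (expR t^-1 * k.+2`!%:R)); last by ring.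
by rewrite ler_pM2l// exprn_gt0.
Qed.

Lemma is_derive0_quadratic (F : R -> R) (C : R) :
  F 0 = 0 -> (forall t, `|F t| <= C * t ^+ 2) -> is_derive (0 : R) (1 : R) F 0.
Proof.
move=> F0 FC.
have h : (fun h : R => h^-1 *: ((F \o shift 0) (h *: (1 : R)) - F 0)) @ 0^' --> (0 : R).
  apply/cvgr0Pnorm_le => e e0.
  have C0 : 0 < `|C| + 1 by rewrite ltr_wpDl.
  near=> t.
  have t0 : t != 0 by near: t; exact: nbhs_dnbhs_neq.
  rewrite /= F0 subr0 addr0 /GRing.scale/= mulr1 normrM normfV.
  rewrite mulrC ler_pdivrMr ?normr_gt0//.
  apply: (le_trans (FC t)).
  have : `|t| <= e / (`|C| + 1).
    near: t; apply: dnbhs0_le; exact: divr_gt0.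
  rewrite ler_pdivlMr// => te.
  rewrite -(real_normK (num_real t)) expr2 mulrA ler_wpM2r//.
  apply: le_trans te; rewrite mulrC ler_wpM2l//.
  by rewrite (le_trans (ler_norm _))// lerDl.
by apply: DeriveDef; [apply/cvg_ex; exists 0|exact: cvg_lim].
Unshelve. all: by end_near. Qed.

Lemma flat_derive k (t : R) :
  is_derive t (1 : R) (flat k) (flat k.+2 t - k%:R * flat k.+1 t).
Proof.
have [t0|t0|->] := ltgtP t 0.
- rewrite /flat ltNge (ltW t0)/= mulr0 subr0.
  apply: (@near_eq_is_derive _ _ _ (fun=> 0)).
    by near=> u; rewrite ltNge ltW//; near: u; exact: lt_nbhsl.
- apply: (@near_eq_is_derive _ _ _ (fun u : R => u ^- k * expR (- u^-1) : R^o)).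
    by near=> u; rewrite /flat (_ : 0 < u)//; near: u; exact: lt_nbhsr.
  have tn0 : t != 0 by rewrite gt_eqF.
  have d1 : is_derive t (1 : R) (fun u : R => u^-1) (- t ^- 2).
    have := @is_deriveV _ (id : R -> R) t 1 1 tn0 (is_derive_id _ _).
    by rewrite /GRing.scale/= mulr1.
  have d2 : is_derive t (1 : R) (fun u : R => u ^- k) (- (k%:R * t ^- k.+1)).
    have -> : (fun u : R => u ^- k) = (fun u : R => u^-1) ^+ k.
      by apply/funext => u; rewrite -exprVn fctE.
    apply: is_derive_eq; rewrite /GRing.scale/= exprVn.
    case: k => [|k]; first by rewrite !mul0r oppr0.
    by rewrite /= mulrN -mulrA -invfM -exprD addn2.
  have d3 : is_derive t (1 : R) (fun u : R => expR (- u^-1)) (expR (- t^-1) * t ^- 2).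
    have d4 : is_derive t (1 : R) (fun u : R => - u^-1) (t ^- 2).
      by rewrite -[X in is_derive _ _ _ X]opprK; apply: is_deriveN.
    exact: (@is_derive1_comp _ expR (fun u : R => - u^-1) _ _ _ (is_derive_expR _) d4).
  apply: (is_derive_eq (is_deriveM d2 d3)).
  rewrite /flat t0 /GRing.scale/=.
  have tk : t ^+ k != 0 by rewrite expf_neq0.
  rewrite !(exprS t k.+1) (exprS t k); set T := t ^+ k in tk *.
  by field; rewrite tn0 tk.
- rewrite /flat ltxx mulr0 subr0.
  apply: (@is_derive0_quadratic _ (k.+2)`!%:R); first by rewrite ltxx.
  by move=> u; rewrite ger0_norm ?flat_ge0//; exact: flat_le.
Unshelve. all: by end_near. Qed.

Lemma nderivable_flat n k : nderivable n (flat k).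
Proof.
have d j t : derivable (flat j) t 1 by have [] := flat_derive j t.
elim: n k => [|n IH] k; split => //.
have -> : derive1 (flat k) =
    (fun t => flat k.+2 t + (fun=> - k%:R) t * flat k.+1 t).
  apply/funext => t; rewrite derive1E mulNr.
  exact: (@derive_val _ _ _ _ _ _ _ (flat_derive k t)).
by apply: nderivableD; [exact: IH|apply: nderivableM; [exact: nderivable_cst|exact: IH]].
Qed.

Definition bump (x : R) : R := flat 0 x * flat 0 (1 - x).

Lemma nderivable_bump n : nderivable n bump.
Proof.
apply: nderivableM; first exact: nderivable_flat.
have -> : (fun x : R => flat 0 (1 - x)) = (fun x => flat 0 (- 1 * x + 1)).
  by apply/funext => x; rewrite mulN1r addrC.
by apply: nderivable_affine; exact: nderivable_flat.
Qed.

Lemma continuous_bump : continuous bump.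
Proof.
move=> x; apply/differentiable_continuous/derivable1_diffP.
exact: (nderivable_derivable (nderivable_bump 0)).
Qed.

Lemma bump_ge0 x : 0 <= bump x.
Proof. by rewrite mulr_ge0// flat_ge0. Qed.

Lemma flat0_le1 x : flat 0 x <= 1.
Proof.
rewrite /flat; case: ifPn => // x0.
by rewrite expr0 invr1 mul1r expR_le1 oppr_le0 invr_ge0 ltW.
Qed.

Lemma bump_le1 x : bump x <= 1.
Proof. by rewrite mulr_ile1// ?flat_ge0// flat0_le1. Qed.

Lemma bump_out x : x \notin `]0, 1[ -> bump x = 0.
Proof.
rewrite in_itv/= negb_and -!leNgt => /orP[x0|x1].
  by rewrite /bump {1}/flat ltNge x0 mul0r.
by rewrite /bump [X in _ * X]/flat subr_gt0 ltNge x1 mulr0.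
Qed.

Lemma bump_gt0 x : x \in `]0, 1[ -> 0 < bump x.
Proof.
rewrite in_itv/= => /andP[x0 x1].
by rewrite mulr_gt0// /flat ?subr_gt0 ?x0 ?x1 expr0 invr1 mul1r expR_gt0.
Qed.

Lemma integrable_bump (A : set R) : measurable A ->
  (@lebesgue_measure R).-integrable A (EFin \o bump).
Proof.
move=> mA; apply: (@integrableS _ _ _ _ setT) => //.
have -> : EFin \o bump = (EFin \o bump) \_ `[0, 1].
  apply/funext => x; rewrite patchE; case: ifPn => // xn.
  rewrite /= bump_out//; apply: contra xn; rewrite inE/=.
  exact: subset_itv_oo_cc.
apply/integrable_restrict => //; rewrite setTI.
apply: continuous_compact_integrable; first exact: segment_compact.
exact/continuous_subspaceT/continuous_bump.
Qed.

(** A smooth step, from [0] on the negative half-line to [ramp 1] beyond [1].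
    Its height is left unnormalised, and divided out in [weak_FTC]. *)
Definition ramp (x : R) : R := \int[lebesgue_measure]_(t in `]-oo, x]) bump t.

Lemma ramp_derive x : is_derive x (1 : R) ramp (bump x).
Proof.
have [||||d <-] := @continuous_FTC1 R bump (BInfty R true) x (x + 1).
- by rewrite ltrDl.
- exact: integrable_bump.
- exact: ltNyr.
- exact: continuous_bump.
- by rewrite derive1E; apply: derivableP.
Qed.

Lemma nderivable_ramp n : nderivable n ramp.
Proof.
apply: nderivableW; split; first by move=> x; have [] := ramp_derive x.
rewrite (_ : derive1 ramp = bump); first exact: nderivable_bump.
apply/funext => x; rewrite derive1E.
exact: (@derive_val _ _ _ _ _ _ _ (ramp_derive x)).
Qed.

Lemma ramp0 x : x <= 0 -> ramp x = 0.
Proof.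
move=> x0; rewrite /ramp; under eq_Rintegral.
  move=> t; rewrite inE/= in_itv/= => tx; rewrite bump_out; last first.
    by rewrite in_itv/= ltNge (le_trans tx x0).
  over.
by rewrite Rintegral_cst ?mul0r.
Qed.

Lemma ramp_homo : {homo ramp : x y / x <= y}.
Proof.
move=> x y xy; rewrite /ramp; apply: fine_le; last first.
- apply: ge0_subset_integral => //.
  + by apply: measurable_int; exact: integrable_bump.
  + by move=> t _; rewrite lee_fin bump_ge0.
  + by apply: subset_itvl; rewrite bnd_simp.
- by apply: integrable_fin_num => //; exact: integrable_bump.
- by apply: integrable_fin_num => //; exact: integrable_bump.
Qed.

Lemma ramp_ge0 x : 0 <= ramp x.
Proof. by apply: Rintegral_ge0 => t _; exact: bump_ge0. Qed.

Lemma ramp_cst x : 1 <= x -> ramp x = ramp 1.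
Proof.
move=> x1; apply/eqP; rewrite -subr_eq0; apply/eqP.
rewrite /ramp Rintegral_itvB//; last exact: integrable_bump.
under eq_Rintegral.
  move=> t; rewrite inE/= in_itv/= => /andP[t1 tx]; rewrite bump_out; last first.
    by rewrite in_itv/= [t < 1]ltNge (ltW t1) andbF.
  over.
by rewrite Rintegral_cst ?mul0r.
Qed.

Lemma ramp_le x : ramp x <= ramp 1.
Proof.
have [x1|x1] := leP 1 x; first by rewrite ramp_cst.
by rewrite ramp_homo// ltW.
Qed.

Lemma ramp1_gt0 : 0 < ramp 1.
Proof.
rewrite lt_neqAle ramp_ge0 andbT; apply/eqP => e.
(* otherwise the monotone function ramp vanishes identically, yet its
   derivative at 1/2 is positive *)
have rc : ramp = cst 0.
  by apply/funext => x; apply/eqP; rewrite eq_le ramp_ge0 andbT e ramp_le.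
have h : (1/2 : R) \in `]0, 1[ by rewrite in_itv/=; lra.
have := bump_gt0 h.
rewrite -(@derive_val _ _ _ _ _ _ _ (ramp_derive (1/2))) rc.
by rewrite derive_cst ltxx.
Qed.

End smooth.

(** * The fundamental theorem of calculus for weak derivatives *)

Section FTC.
Context {R : realType}.
Implicit Types F f g : R -> R.
Local Notation leb := (@lebesgue_measure R).

Lemma is_derive_continuous F f :
  (forall x, is_derive x (1 : R) F (f x)) -> continuous F.
Proof.
move=> d x; apply/differentiable_continuous/derivable1_diffP.
by have [] := d x.
Qed.

Lemma FTC2_total F f (a b : R) : a < b ->
  (forall x, is_derive x (1 : R) F (f x)) -> continuous f ->
  (\int[leb]_(x in `[a, b]) (f x)%:E = (F b - F a)%:E)%E.
Proof.
move=> ab d cf; have cF := is_derive_continuous d.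
rewrite (@continuous_FTC2 _ f F)//.
- exact: continuous_subspaceT.
- split.
  + by move=> x _; have [] := d x.
  + exact/cvg_at_right_filter/cF.
  + exact/cvg_at_left_filter/cF.
- move=> x _; rewrite derive1E; exact: (@derive_val _ _ _ _ _ _ _ (d x)).
Qed.

Lemma RFTC2_total F f (a b : R) : a < b ->
  (forall x, is_derive x (1 : R) F (f x)) -> continuous f ->
  \int[leb]_(x in `[a, b]) f x = F b - F a.
Proof. by move=> ab d cf; rewrite /Rintegral (FTC2_total ab d cf). Qed.

End FTC.

Section mollifier.
Context {R : realType}.
Implicit Types F f g : R -> R.
Local Notation leb := (@lebesgue_measure R).

Lemma is_derive_ramp_scale (x e t : R) :
  is_derive t (1 : R) (fun t => ramp ((t - x) / e)) (e^-1 * bump ((t - x) / e)).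
Proof.
have d1 : is_derive t (1 : R) (fun t : R => (t - x) / e) e^-1.
  have : is_derive t (1 : R) (e^-1 \*: ((id : R -> R^o) - cst x)) (e^-1 *: (1 - 0)).
    exact: is_deriveZ.
  rewrite subr0 /GRing.scale/= mulr1.
  by congr (is_derive _ _ _ _); apply/funext => u; rewrite mulrC.
by have := @is_derive1_comp _ ramp (fun t : R => (t - x) / e) _ _ _
  (ramp_derive ((t - x) / e)) d1; rewrite mulrC.
Qed.

Lemma continuous_bump_scale (x e : R) :
  continuous (fun t : R => e^-1 * bump ((t - x) / e)).
Proof.
move=> t; apply: cvgMl_tmp.
apply: (@continuous_comp _ _ _ (fun t : R => (t - x) / e) bump).
  by apply: cvgMr_tmp; apply: cvgB; [exact: cvg_id|exact: cvg_cst].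
exact: continuous_bump.
Qed.

Lemma bump_scale_out (x e t : R) : 0 < e -> t \notin `[x, x + e] ->
  bump ((t - x) / e) = 0.
Proof.
move=> e0 tn; apply: bump_out; apply: contra tn.
rewrite !in_itv/= ltr_pdivrMr// mul1r pmulr_lgt0 ?invr_gt0// subr_gt0 ltrBlDl.
by move=> /andP[/ltW -> /ltW ->].
Qed.

Definition mollifier (x e t : R) : R := e^-1 * bump ((t - x) / e).

Lemma mollifier_ge0 x e t : 0 < e -> 0 <= mollifier x e t.
Proof. by move=> e0; rewrite mulr_ge0 ?bump_ge0// invr_ge0 ltW. Qed.

Lemma mollifier_le x e t : 0 < e -> mollifier x e t <= e^-1.
Proof. by move=> e0; rewrite ler_piMr ?bump_le1// invr_ge0 ltW. Qed.

Lemma measurable_mollifier (x e : R) : measurable_fun setT (mollifier x e).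
Proof. apply: continuous_measurable_fun; exact: continuous_bump_scale. Qed.

Lemma mollifier_restrict (x e : R) : 0 < e ->
  mollifier x e = (mollifier x e) \_ `[x, x + e].
Proof.
move=> e0; apply/funext => t; rewrite patchE; case: ifPn => // tn.
rewrite /mollifier bump_scale_out ?mulr0//.
by apply: contra tn; rewrite inE.
Qed.

Lemma integrable_mollifier (x e : R) : 0 < e ->
  leb.-integrable setT (EFin \o mollifier x e).
Proof.
move=> e0; rewrite mollifier_restrict//.
rewrite -restrict_EFin; apply/integrable_restrict => //; rewrite setTI.
apply: continuous_compact_integrable; first exact: segment_compact.
exact/continuous_subspaceT/continuous_bump_scale.
Qed.

Lemma Rintegral_mollifier (x e : R) : 0 < e ->
  \int[leb]_t mollifier x e t = ramp 1.
Proof.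
move=> e0; rewrite mollifier_restrict// -Rintegral_mkcond.
have xe : x < x + e by rewrite ltrDl.
rewrite (RFTC2_total xe (is_derive_ramp_scale x e) (@continuous_bump_scale x e)).
rewrite (_ : (x + e - x) / e = 1); last by field; rewrite gt_eqF.
by rewrite subrr mul0r [ramp 0]ramp0// subr0.
Qed.

Lemma integrable_mul_mollifier f (x e : R) : 0 < e ->
  leb.-integrable setT (EFin \o f) ->
  leb.-integrable setT (EFin \o (fun t => f t * mollifier x e t)).
Proof.
move=> e0 fi.
have -> : EFin \o (fun t => f t * mollifier x e t) =
    ((EFin \o mollifier x e) \* (EFin \o f))%E.
  by apply/funext => t /=; rewrite mulrC EFinM.
apply: integrableMr => //; first exact: measurable_mollifier.
exists e^-1; split; first exact: num_real.
move=> M eM t _ /=; rewrite ger0_norm ?mollifier_ge0//.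
by rewrite (le_trans (mollifier_le _ _ e0))// ltW.
Qed.

(** [mollifier x e] has mass [ramp 1], height at most [1/e], and is supported in
    [[x, x+e]], hence in the ball of radius [2e] about [x]; the error is an
    average of [|f - f x|] over that ball. *)
Lemma mollifier_error f (x e : R) : 0 < e ->
  leb.-integrable setT (EFin \o f) ->
  (`|\int[leb]_t (f t * mollifier x e t) - f x * ramp 1|%:E
    <= 4%:E * davg f x (2 * e))%E.
Proof.
move=> e0 fi; have mf : measurable_fun setT f.
  by move/measurable_int : fi => /measurable_EFinP.
rewrite -(Rintegral_mollifier x e0) -RintegralZl//; last exact: integrable_mollifier.
rewrite -RintegralB//; last 2 first.
- exact: integrable_mul_mollifier.
- by have := integrableZl measurableT (f x) (integrable_mollifier x e0).
have iD : leb.-integrable setT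
    (EFin \o (fun t => f t * mollifier x e t - f x * mollifier x e t)).
  have := integrableB measurableT (integrable_mul_mollifier x e0 fi)
    (integrableZl measurableT (f x) (integrable_mollifier x e0)).
  by apply: eq_integrable.
rewrite EFin_normr_Rintegral//.
apply: (le_trans (le_abse_integral _ _ _)) => //; first by move/measurable_int : iD.
have mb : measurable (ball x (2 * e)) by exact: measurable_ball.
have mfx : measurable_fun setT (fun y => `|(f y - f x)%:E|%E).
  by apply/measurableT_comp => //; apply/measurable_EFinP; exact: measurable_funB.
apply: (@le_trans _ _ (\int[leb]_(t in ball x (2 * e)) (e^-1%:E * `|(f t - f x)%:E|))%E).
  rewrite [leRHS]integral_mkcond; apply: ge0_le_integral => //.
  - by apply/measurableT_comp => //; move/measurable_int : iD.
  - apply/(measurable_restrictT _ _).1 => //.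
    by apply: measurable_funTS; apply: measurable_funeM.
  - move=> t _; rewrite patchE -mulrBl.
    case: ifPn => [_|tn].
      rewrite -EFinM lee_fin normrM mulrC ler_wpM2r//.
      by rewrite ger0_norm ?mollifier_le ?mollifier_ge0.
    have -> : mollifier x e t = 0.
      rewrite /mollifier bump_scale_out ?mulr0//; apply: contra tn.
      rewrite inE in_itv/= ball_itv/= in_itv/= => /andP[h1 h2].
      by apply/andP; split; lra.
    by rewrite mulr0 /= normr0.
rewrite ge0_integralZl//; last 2 first.
- exact: measurable_funTS.
- by rewrite lee_fin invr_ge0 ltW.
(* the ball has measure 4e, whence the factor 4 = 4e / e *)
rewrite /davg /iavg muleA lebesgue_measure_ball; last by rewrite mulr_ge0// ltW.
rewrite inver mulrn_eq0/= mulf_eq0 pnatr_eq0/= gt_eqF//.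
rewrite -EFinM lee_pmul//=.
- by rewrite lee_fin invr_ge0 ltW.
- exact: integral_ge0.
- rewrite lee_fin -(mulr_natr (2 * e) 2) !invfM.
  by rewrite le_eqVlt; apply/orP; left; apply/eqP; field; rewrite gt_eqF.
Qed.

Lemma mollifier_cvg f (x : R) (e : nat -> R) : (forall n, 0 < e n) ->
  e @ \oo --> 0 -> leb.-integrable setT (EFin \o f) -> lebesgue_pt f x ->
  (fun n => \int[leb]_t (f t * mollifier x (e n) t)) @ \oo --> f x * ramp 1.
Proof.
move=> e0 ecvg fi fx.
have h : (fun n => 4%:E * davg f x (2 * e n))%E @ \oo --> 0%E.
  rewrite -(mule0 (4%:E)); apply: cvgeZl => //.
  have e2 : (fun n => 2 * e n) @ \oo --> 0^'+.
    have e2 : (fun n => 2 * e n) @ \oo --> (0 : R).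
      by rewrite -[X in _ --> X](mulr0 2); apply: cvgMl_tmp.
    move=> A /e2; rewrite /nbhs/=; apply: filterS => n /=; apply.
    by rewrite mulr_gt0.
  exact: (cvg_comp _ _ e2 fx).
have h2 : (fun n => `|\int[leb]_t (f t * mollifier x (e n) t) - f x * ramp 1|%:E)%E @ \oo --> 0%E.
  apply: (squeeze_cvge _ (cvg_cst 0%E) h).
  by apply: nearW => n; rewrite lee_fin normr_ge0/=; exact: mollifier_error.
apply/subr_cvg0; apply: norm_cvg0.
exact: (fine_cvg h2).
Qed.

End mollifier.

Section weak_FTC.
Context {R : realType}.
Implicit Types f g : R -> R.
Local Notation leb := (@lebesgue_measure R).

(** A smooth version of the indicator of [[x1, x2]], times [ramp 1]; its
    derivative is a mollifier at [x1] minus a mollifier at [x2]. *)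
Definition plateau (x1 x2 e t : R) : R := ramp ((t - x1) / e) - ramp ((t - x2) / e).

Lemma is_derive_plateau x1 x2 e t : is_derive t (1 : R) (plateau x1 x2 e)
  (mollifier x1 e t - mollifier x2 e t).
Proof.
by apply: (is_deriveB (is_derive_ramp_scale x1 e t) (is_derive_ramp_scale x2 e t)).
Qed.

Lemma derive1_plateau x1 x2 e :
  derive1 (plateau x1 x2 e) = fun t => mollifier x1 e t - mollifier x2 e t.
Proof.
apply/funext => t; rewrite derive1E.
exact: (@derive_val _ _ _ _ _ _ _ (is_derive_plateau x1 x2 e t)).
Qed.

Lemma nderivable_plateau n x1 x2 e : nderivable n (plateau x1 x2 e).
Proof.
have H x : nderivable n (fun t => ramp ((t - x) / e)).
  have -> : (fun t => ramp ((t - x) / e)) = (fun t => ramp (e^-1 * t + (- x / e))).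
    by apply/funext => t; rewrite mulrBl mulNr mulrC.
  by apply: nderivable_affine; exact: nderivable_ramp.
have -> : plateau x1 x2 e = (fun t => ramp ((t - x1) / e) +
    (fun=> -1) t * ramp ((t - x2) / e)).
  by apply/funext => t; rewrite mulN1r.
by apply: nderivableD => //; apply: nderivableM => //; exact: nderivable_cst.
Qed.

Lemma plateau_supp x1 x2 e : 0 < e -> x1 <= x2 ->
  [set t | plateau x1 x2 e t != 0] `<=` `[x1, x2 + e].
Proof.
move=> e0 x12 t /=; apply: contraR.
rewrite in_itv/= negb_and -!ltNge /plateau => /orP[tx|tx].
  rewrite !ramp0 ?subrr// pmulr_lle0 ?invr_gt0//; lra.
rewrite !ramp_cst ?subrr// ler_pdivlMr//; lra.
Qed.

Lemma plateau_test x1 x2 e : 0 < e -> x1 <= x2 -> - pi < x1 -> x2 + e < pi ->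
  test_function (plateau x1 x2 e).
Proof.
move=> e0 x12 px1 px2.
have cl : closure [set t | plateau x1 x2 e t != 0] `<=` `[x1, x2 + e].
  apply: subset_trans (closure_subset (plateau_supp e0 x12)) _.
  by have /closure_id <- : closed (`[x1, x2 + e] : set R) by exact: itv_closed.
split.
- by move=> n x; apply: (nderivable_derive1n (nderivable_plateau _ _ _ _)).
- apply: (subclosed_compact _ (@segment_compact _ x1 (x2 + e))) => //.
  exact: closed_closure.
- apply: subset_trans cl _ => t /=.
  rewrite /U/= !in_itv/= => /andP[h1 h2].
  by rewrite (lt_le_trans px1 h1) (le_lt_trans h2 px2).
Qed.

Lemma plateau_bound x1 x2 e t : 0 < e -> x1 <= x2 -> `|plateau x1 x2 e t| <= ramp 1.
Proof.
move=> e0 x12; rewrite ger0_norm.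
  by rewrite lerBlDr (le_trans (ramp_le _))// lerDl ramp_ge0.
by rewrite subr_ge0; apply: ramp_homo; rewrite ler_pM2r ?invr_gt0// lerB.
Qed.

Lemma ramp_scale_cvg (e : nat -> R) (x t : R) : (forall n, 0 < e n) ->
  e @ \oo --> 0 ->
  (fun n => ramp ((t - x) / e n)) @ \oo --> (if x < t then ramp 1 else 0).
Proof.
move=> e0 ecvg; case: ifPn => xt; apply: cvg_near_cst.
  have : \forall n \near \oo, e n < t - x.
    by move: ecvg => /cvgr_lt; apply; rewrite subr_gt0.
  apply: filterS => n h; apply: ramp_cst.
  by rewrite ler_pdivlMr// mul1r ltW.
by apply: nearW => n; rewrite ramp0// pmulr_lle0 ?invr_gt0// subr_le0 leNgt.
Qed.

(** Test the weak derivative against [plateau x1 x2 e] and let [e] tend to [0]: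
    at Lebesgue points the left side tends to [ramp 1 * (f x1 - f x2)], and the
    right side to [ramp 1] times minus the integral of [g] by dominated
    convergence. *)
Lemma weak_FTC f g (x1 x2 : R) :
  leb.-integrable setT (EFin \o f) -> leb.-integrable setT (EFin \o g) ->
  (forall phi : R -> R, test_function phi ->
     \int[leb]_t (f t * derive1 phi t) = - \int[leb]_t (g t * phi t)) ->
  - pi < x1 -> x1 <= x2 -> x2 < pi -> lebesgue_pt f x1 -> lebesgue_pt f x2 ->
  f x2 - f x1 = \int[leb]_(t in `]x1, x2]) g t.
Proof.
move=> fi gi fg px1 x12 px2 lf1 lf2.
(* the widths e n stay below pi - x2, to keep the plateaus supported in U *)
pose d := (pi - x2) / 2.
have d0 : 0 < d by rewrite divr_gt0// subr_gt0.
pose e n : R := d / n.+1%:R.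
have e0 n : 0 < e n by rewrite divr_gt0.
have ecvg : e @ \oo --> 0.
  by rewrite -[X in _ --> X](mulr0 d); apply: cvgMl_tmp; exact: cvg_harmonic.
have ed n : x2 + e n < pi.
  have : e n <= d by rewrite ler_pdivrMr// ler_peMr ?ler1n// ltW.
  have : d + d = pi - x2 by rewrite /d; field.
  lra.
have lhs : (fun n => \int[leb]_t (f t * derive1 (plateau x1 x2 (e n)) t)) @ \oo
    --> f x1 * ramp 1 - f x2 * ramp 1.
  under eq_fun.
    move=> n; rewrite derive1_plateau; under eq_Rintegral do rewrite mulrBr.
    rewrite RintegralB//; [|exact: integrable_mul_mollifier..].
    over.
  by apply: cvgB; exact: mollifier_cvg.
have mg : measurable_fun setT g.
  by move/measurable_int : gi => /measurable_EFinP.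
have mpl n : measurable_fun setT (plateau x1 x2 (e n)).
  apply: continuous_measurable_fun.
  exact: (is_derive_continuous (is_derive_plateau x1 x2 (e n))).
pose G t := g t * (if x1 < t then ramp 1 else 0) - g t * (if x2 < t then ramp 1 else 0).
have rhs : (fun n => \int[leb]_t (g t * plateau x1 x2 (e n) t)) @ \oo
    --> \int[leb]_t G t.
  have cvgpt t : (fun n => (g t * plateau x1 x2 (e n) t)) @ \oo --> G t.
    rewrite /G -mulrBr; apply: cvgMl_tmp.
    by apply: cvgB; exact: ramp_scale_cvg.
  have mGn n : measurable_fun setT (fun t => g t * plateau x1 x2 (e n) t).
    exact: measurable_funM.
  have mG : measurable_fun setT G.
    apply: (measurable_fun_cvg (h := fun n t => g t * plateau x1 x2 (e n) t)) => //.
  have [|||||iG _ h] := @dominated_convergence _ (measurableTypeR R) R leb setT measurableT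
    (fun n => EFin \o (fun t => g t * plateau x1 x2 (e n) t)) (EFin \o G)
    (fun t => ((ramp 1)%:E * `|(g t)%:E|)%E).
  - move=> n; apply/measurable_EFinP. exact: mGn.
  - exact/measurable_EFinP.
  - by apply: aeW => t _ /=; apply/cvg_EFin; [exact: nearW|exact: cvgpt].
  - by apply: integrableZl => //; apply: integrable_abse.
  - apply: aeW => t n _ /=; rewrite -EFinM lee_fin normrM mulrC.
    by rewrite ler_wpM2r// plateau_bound.
  apply: fine_cvg; rewrite fineK//; exact: integrable_fin_num iG.
have key : f x1 * ramp 1 - f x2 * ramp 1 = - \int[leb]_t G t.
  have E : (fun n => \int[leb]_t (f t * derive1 (plateau x1 x2 (e n)) t)) =
      (fun n => - \int[leb]_t (g t * plateau x1 x2 (e n) t)).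
    by apply/funext => n; rewrite fg//; exact: plateau_test.
  rewrite E in lhs; exact: (cvg_unique (@norm_hausdorff _ R) lhs (cvgN rhs)).
have GE : \int[leb]_t G t = ramp 1 * \int[leb]_(t in `]x1, x2]) g t.
  rewrite -RintegralZl//; last exact: integrableS gi.
  have -> : G = (fun t => ramp 1 * g t) \_ `]x1, x2].
    apply/funext => t; rewrite patchE /G.
    have -> : (t \in `]x1, x2]%classic) = (x1 < t) && (t <= x2).
      apply/idP/idP => [/set_mem/=|tx]; first by rewrite in_itv.
      by apply/mem_set; rewrite /= in_itv.
    have [x1t/=|tx1/=] := ltP x1 t.
      by case: ltP => _; rewrite ?subrr// mulr0 subr0 mulrC.
    by rewrite ltNge (le_trans tx1 x12)/= !mulr0 subrr.
  by rewrite -Rintegral_mkcond.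
move: key; rewrite GE -mulrBl => /eqP; rewrite -subr_eq0 opprK [_ * ramp 1]mulrC -mulrDr.
rewrite mulf_eq0 gt_eqF ?ramp1_gt0//= => /eqP h; lra.
Qed.

End weak_FTC.

(** * A Hardy inequality by the Tonelli theorem *)

Section tonelli.
Context {R : realType}.
Local Notation leb := (@lebesgue_measure R).
Local Notation T := (measurableTypeR R).

Definition measurable2 (F : R -> R -> R) :=
  measurable_fun [set: (T * T)%type] (fun z : T * T => F z.1 z.2 : T).

Lemma measurable2_fst (f : R -> R) : measurable_fun setT f ->
  measurable2 (fun s _ => f s).
Proof.
move=> mf; have mf' : measurable_fun [set: T] (f : T -> T) := mf.
exact: (measurableT_comp mf' measurable_fst).
Qed.

Lemma measurable2_snd (f : R -> R) : measurable_fun setT f ->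
  measurable2 (fun _ t => f t).
Proof.
move=> mf; have mf' : measurable_fun [set: T] (f : T -> T) := mf.
exact: (measurableT_comp mf' measurable_snd).
Qed.

Lemma measurable2M (F G : R -> R -> R) : measurable2 F -> measurable2 G ->
  measurable2 (fun s t => F s t * G s t).
Proof. by move=> mF mG; exact: (measurable_funM mF mG). Qed.

Lemma measurable2D (F G : R -> R -> R) : measurable2 F -> measurable2 G ->
  measurable2 (fun s t => F s t + G s t).
Proof. by move=> mF mG; exact: (measurable_funD mF mG). Qed.

Lemma measurable2_swap (F : R -> R -> R) : measurable2 F ->
  measurable2 (fun s t => F t s).
Proof. by move=> mF; have := measurableT_comp mF (@measurable_swap _ _ T T); exact. Qed.

Lemma measurable2_row (F : R -> R -> R) (s : R) : measurable2 F ->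
  measurable_fun setT (F s).
Proof.
move=> mF; have := measurableT_comp mF (measurable_pair1 (s : T)).
exact.
Qed.

Definition on_path (s x : R) : bool := (0 <= s <= x) || (x <= s <= 0).
Definition path_indic (s x : R) : R := if on_path s x then 1 else 0.

Lemma path_indic_ge0 s x : 0 <= path_indic s x. Proof. by rewrite /path_indic; case: ifP. Qed.
Lemma path_indic_le1 s x : path_indic s x <= 1. Proof. by rewrite /path_indic; case: ifP. Qed.

(** Of two points of the segment joining [0] and [x], one lies between [0] and
    the other.  This replaces the differentiation of [travel g ^+ 2]. *)
Lemma path_indic_split (s t x : R) :
  (path_indic s x * path_indic t x <= path_indic s x * path_indic t s + path_indic t x * path_indic s t)%R.
Proof.
rewrite /path_indic /on_path; case: ifP => [|_]; last first.
  by rewrite !mul0r add0r mulr_ge0//; case: ifP.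
case: ifP => [|_ _]; last by rewrite mulr0 mul0r addr0 mulr_ge0//; case: ifP.
move=> ht hs; rewrite !mul1r.
have : ((0 <= t <= s) || (s <= t <= 0) || ((0 <= s <= t) || (t <= s <= 0)))%R.
  by move: ht hs; do ! [case: lerP => /= ?]; lra.
case/orP => ->; last by rewrite lerDr; case: ifP.
by rewrite lerDl; case: ifP.
Qed.

Lemma measurable2_path_indic : measurable2 path_indic.
Proof.
have m1 : measurable_fun [set: (T * T)%type] (fun z : T * T => z.1 : R) := measurable_fst.
have m2 : measurable_fun [set: (T * T)%type] (fun z : T * T => z.2 : R) := measurable_snd.
have m0 : measurable_fun [set: (T * T)%type] (fun z : T * T => 0 : R) by exact: measurable_cst.
have H : measurable_fun [set: (T * T)%type] (fun z : T * T => on_path z.1 z.2).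
  by apply: measurable_or; apply: measurable_and; apply: measurable_fun_ler.
by apply: (measurable_fun_ifT H); exact: measurable_cst.
Qed.

Local Open Scope ereal_scope.

Lemma ge0_tonelli (F : R -> R -> R) : measurable2 F -> (forall s t, 0 <= F s t)%R ->
  \int[leb]_s \int[leb]_t (F s t)%:E = \int[leb]_t \int[leb]_s (F s t)%:E.
Proof.
move=> mF F0.
have := @fubini_tonelli _ _ _ _ R leb leb (fun z => (F z.1 z.2)%:E).
apply; last by move=> z; rewrite lee_fin.
by apply/measurable_EFinP; exact: mF.
Qed.

Lemma measurable_tonelli (F : R -> R -> R) : measurable2 F -> (forall s t, 0 <= F s t)%R ->
  measurable_fun setT (fun s => \int[leb]_t (F s t)%:E).
Proof.
move=> mF F0.
have := @measurable_fun_fubini_tonelli_F _ _ _ _ R leb (fun z => (F z.1 z.2)%:E).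
apply; last by move=> z; rewrite lee_fin.
by apply/measurable_EFinP; exact: mF.
Qed.

Lemma ge0_integralD2 (F G : R -> R -> R) : measurable2 F -> measurable2 G ->
  (forall s t, 0 <= F s t)%R -> (forall s t, 0 <= G s t)%R ->
  \int[leb]_s \int[leb]_t (F s t + G s t)%:E =
  \int[leb]_s \int[leb]_t (F s t)%:E + \int[leb]_s \int[leb]_t (G s t)%:E.
Proof.
move=> mF mG F0 G0; rewrite -ge0_integralD//.
- apply: eq_integral => s _; rewrite -ge0_integralD//.
  + by move=> t _; rewrite lee_fin.
  + by apply/measurable_EFinP; exact: measurable2_row.
  + by move=> t _; rewrite lee_fin.
  + by apply/measurable_EFinP; exact: measurable2_row.
- by move=> s _; apply: integral_ge0 => t _; rewrite lee_fin.
- exact: measurable_tonelli.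
- by move=> s _; apply: integral_ge0 => t _; rewrite lee_fin.
- exact: measurable_tonelli.
Qed.

Lemma le_integral2 (F G : R -> R -> R) : measurable2 F -> measurable2 G ->
  (forall s t, 0 <= F s t)%R -> (forall s t, F s t <= G s t)%R ->
  \int[leb]_s \int[leb]_t (F s t)%:E <= \int[leb]_s \int[leb]_t (G s t)%:E.
Proof.
move=> mF mG F0 FG; apply: ge0_le_integral => //.
- by move=> s _; apply: integral_ge0 => t _; rewrite lee_fin.
- exact: measurable_tonelli.
- apply: measurable_tonelli => // s t; exact: le_trans (FG _ _).
- move=> s _; apply: ge0_le_integral => //.
  + by move=> t _; rewrite lee_fin.
  + by apply/measurable_EFinP; exact: measurable2_row.
  + by apply/measurable_EFinP; exact: measurable2_row.
  + by move=> t _; rewrite lee_fin.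
Qed.

End tonelli.

Section hardy.
Context {R : realType} (g : R -> R).
Local Notation leb := (@lebesgue_measure R).
Hypothesis gi : leb.-integrable setT (EFin \o g).
Local Open Scope ereal_scope.

(** For [g] the derivative of [f], the length of the path run by [f] between the
    times [0] and [x]. *)
Definition travel (x : R) : R := (\int[leb]_s (`|g s| * path_indic s x))%R.

Let mg : measurable_fun setT (fun s => `|g s|)%R.
Proof.
apply: measurableT_comp => //.
by move/measurable_int : gi => /measurable_EFinP.
Qed.

Let measurable_path_indicl (x : R) : measurable_fun setT (path_indic ^~ x).
Proof. exact: (measurable2_row x (measurable2_swap measurable2_path_indic)). Qed.

Let mgk (x : R) : measurable_fun setT (fun s => `|g s| * path_indic s x)%R.
Proof. exact: measurable_funM. Qed.

Let gk_ge0 s x : (0 <= `|g s| * path_indic s x)%R.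
Proof. by rewrite mulr_ge0// path_indic_ge0. Qed.

Lemma travel_integrable x :
  leb.-integrable setT (EFin \o (fun s => `|g s| * path_indic s x))%R.
Proof.
apply: (le_integrable measurableT _ _ gi) => //.
  by apply/measurable_EFinP; exact: mgk.
move=> s _ /=; rewrite lee_fin ger0_norm// ler_piMr//.
exact: path_indic_le1.
Qed.

Lemma travelE x : (travel x)%:E = \int[leb]_s (`|g s| * path_indic s x)%:E.
Proof.
rewrite /travel /Rintegral fineK//; exact: integrable_fin_num (travel_integrable x).
Qed.

Lemma travel_ge0 x : (0 <= travel x)%R.
Proof. by apply: Rintegral_ge0. Qed.

Lemma measurable_travel : measurable_fun setT travel.
Proof.
apply/measurable_EFinP.
rewrite [_ \o _](_ : _ = fun x => \int[leb]_s (`|g s| * path_indic s x)%:E); last first.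
  by apply/funext => x /=; rewrite travelE.
apply: (@measurable_tonelli _ (fun x s => `|g s| * path_indic s x)%R) => //.
apply: measurable2M; first exact: measurable2_snd.
exact: (measurable2_swap measurable2_path_indic).
Qed.

Lemma travel_bound : exists2 A : R, (0 <= A)%R & forall x, (travel x <= A)%R.
Proof.
exists (\int[leb]_s `|g s|)%R; first exact: Rintegral_ge0.
move=> x; apply: le_Rintegral => //; first exact: travel_integrable.
- by have := integrable_norm gi.
- by move=> s _; rewrite ler_piMr// path_indic_le1.
Qed.

(** The integrated form of [(H^2)' = 2 |g| H]: write [H x ^+ 2] as a double
    integral over pairs of points, and order each pair by [path_indic_split]. *)
Lemma travel_sqr x : (travel x ^+ 2)%:E <=
  \int[leb]_s (2 * `|g s| * travel s * path_indic s x)%:E.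
Proof.
pose a s t := (`|g s| * path_indic s x * (`|g t| * path_indic t x))%R.
pose b s t := (`|g s| * path_indic s x * (`|g t| * path_indic t s))%R.
have a0 s t : (0 <= a s t)%R by rewrite mulr_ge0.
have b0 s t : (0 <= b s t)%R by rewrite mulr_ge0.
have ma : measurable2 a.
  by apply: measurable2M; [apply: measurable2_fst|apply: measurable2_snd].
have mb : measurable2 b.
  apply: measurable2M; first exact: measurable2_fst.
  apply: measurable2M; first exact: measurable2_snd.
  exact: (measurable2_swap measurable2_path_indic).
have Ea : (travel x ^+ 2)%:E = \int[leb]_s \int[leb]_t (a s t)%:E.
  rewrite expr2 EFinM {2}travelE.
  rewrite -ge0_integralZl//; last 3 first.
  - by apply/measurable_EFinP; exact: mgk.
  - by move=> s _; rewrite lee_fin.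
  - by rewrite lee_fin travel_ge0.
  apply: eq_integral => s _; rewrite muleC travelE /a.
  rewrite -ge0_integralZl//.
  - by apply/measurable_EFinP; exact: mgk.
  - by move=> t _; rewrite lee_fin.
  - by rewrite lee_fin.
have Eb : \int[leb]_s \int[leb]_t (b s t)%:E =
    \int[leb]_s (`|g s| * path_indic s x * travel s)%:E.
  apply: eq_integral => s _; rewrite [RHS]EFinM travelE -ge0_integralZl//.
  - by apply/measurable_EFinP; exact: mgk.
  - by move=> t _; rewrite lee_fin.
  - by rewrite lee_fin.
rewrite Ea.
apply: (@le_trans _ _ (\int[leb]_s \int[leb]_t (b s t + b t s)%:E)).
  apply: le_integral2 => //.
    by apply: measurable2D => //; exact: measurable2_swap.
  move=> s t; rewrite /a /b.
  rewrite [leLHS](_ : _ = `|g s| * `|g t| * (path_indic s x * path_indic t x))%R; last by ring.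
  rewrite [leRHS](_ : _ = `|g s| * `|g t| * (path_indic s x * path_indic t s + path_indic t x * path_indic s t))%R; last by ring.
  by rewrite ler_wpM2l ?path_indic_split// mulr_ge0.
rewrite ge0_integralD2//; last exact: measurable2_swap.
rewrite -(ge0_tonelli mb)// Eb -ge0_integralD//; last 4 first.
- by move=> s _; rewrite lee_fin mulr_ge0// travel_ge0.
- by apply/measurable_EFinP; apply: measurable_funM; [exact: mgk|exact: measurable_travel].
- by move=> s _; rewrite lee_fin mulr_ge0// travel_ge0.
- by apply/measurable_EFinP; apply: measurable_funM; [exact: mgk|exact: measurable_travel].
rewrite le_eqVlt; apply/orP; left; apply/eqP; apply: eq_integral => s _.
by rewrite -EFinD; congr EFin; ring.
Qed.

Lemma hardy_tonelli (v : R -> R) : measurable_fun setT v -> (forall x, 0 <= v x)%R ->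
  \int[leb]_x (travel x ^+ 2 * v x)%:E <=
  \int[leb]_s ((2 * `|g s| * travel s)%:E * \int[leb]_x (path_indic s x * v x)%:E).
Proof.
move=> mv v0; pose F x s := (2 * `|g s| * travel s * path_indic s x * v x)%R.
have mgt : measurable_fun setT (fun s => 2 * `|g s| * travel s)%R.
  apply: measurable_funM; last exact: measurable_travel.
  exact: measurable_funM.
have gt0 s : (0 <= 2 * `|g s| * travel s)%R by rewrite !mulr_ge0// travel_ge0.
have mF : measurable2 F.
  apply: measurable2M; last exact: measurable2_fst.
  apply: measurable2M; first exact: measurable2_snd.
  exact: (measurable2_swap measurable2_path_indic).
have F0 x s : (0 <= F x s)%R by rewrite !mulr_ge0// ?travel_ge0// path_indic_ge0.
have mgtk x : measurable_fun setT (fun s => 2 * `|g s| * travel s * path_indic s x)%R.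
  exact: measurable_funM.
apply: (@le_trans _ _ (\int[leb]_x \int[leb]_s (F x s)%:E)).
  apply: ge0_le_integral => //.
  - by move=> x _; rewrite lee_fin mulr_ge0// sqr_ge0.
  - apply/measurable_EFinP; apply: measurable_funM => //.
    by apply: measurable_funX; exact: measurable_travel.
  - exact: measurable_tonelli.
  - move=> x _; rewrite EFinM /F.
    under [leRHS]eq_integral do rewrite EFinM muleC.
    rewrite ge0_integralZl//; last 3 first.
    + by apply/measurable_EFinP; exact: mgtk.
    + by move=> s _; rewrite lee_fin mulr_ge0// path_indic_ge0.
    + by rewrite lee_fin.
    by rewrite muleC lee_wpmul2l ?lee_fin//; exact: travel_sqr.
rewrite ge0_tonelli// le_eqVlt; apply/orP; left; apply/eqP; apply: eq_integral => s _.
rewrite -ge0_integralZl//.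
- by apply: eq_integral => x _; rewrite -EFinM /F mulrA.
- apply/measurable_EFinP; apply: measurable_funM => //.
  exact: (measurable2_row s measurable2_path_indic).
- by move=> x _; rewrite lee_fin mulr_ge0// path_indic_ge0.
- by rewrite lee_fin.
Qed.

End hardy.

(** * Gaussian tails of the Gibbs density *)

Section cos_gap.
Context {R : realType}.
Implicit Types s x a : R.

Lemma sin_abs_le x : `|sin x| <= `|x|.
Proof.
have H (y : R) : 0 < y -> `|sin y| <= y.
  move=> y0; have [c _] := @MVT R (@sin R) cos 0 y y0 (fun z _ => is_derive_sin z)
    (continuous_subspaceT (@continuous_sin R)).
  rewrite sin0 !subr0 => ->; rewrite normrM (gtr0_norm y0) ler_piMl ?cos_max//.
  exact: ltW.
have [x0|x0|->] := ltgtP x 0.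
- by rewrite -normrN -sinN -[leRHS]normrN [leRHS]ger0_norm ?H ?oppr_gt0// oppr_ge0 ltW.
- by rewrite [leRHS]ger0_norm ?H// ltW.
- by rewrite sin0 !normr0.
Qed.

Lemma cos_ge_quadratic x : 1 - cos x <= x ^+ 2 / 2.
Proof.
have -> : cos x = 1 - 2 * sin (x / 2) ^+ 2.
  rewrite {1}(_ : x = x / 2 + x / 2); last by field.
  by rewrite cosD -!expr2 cos2sin2; ring.
have : sin (x / 2) ^+ 2 <= (x / 2) ^+ 2.
  by rewrite -[leLHS]real_normK ?num_real// -[leRHS]real_normK ?num_real// lerXn2r ?nnegrE// sin_abs_le.
nra.
Qed.

Lemma cos_sqr_ge_half x : 0 <= x <= pi / 4 -> 2^-1 <= cos x ^+ 2.
Proof.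
move=> /andP[x0 x4].
have : 0 <= cos (x + x).
  by have := pi_gt0 R => p0; apply: cos_ge0_pihalf; lra.
by rewrite cosD -!expr2 sin2cos2; lra.
Qed.

(** Write [sin a = 2 sin (a/2) cos (a/2)], where [sin (a/2)] is [a/2] times a
    cosine by the mean value theorem; both cosines are taken in [[0, pi/4]],
    where their squares are at least 1/2. *)
Lemma sin_ge_half a : 0 <= a <= pi / 2 -> a / 2 <= sin a.
Proof.
move=> /andP[a0 ah].
have [->|an0] := eqVneq a 0; first by rewrite mul0r sin0.
have b0 : 0 < a / 2 by rewrite divr_gt0// lt_neqAle eq_sym an0.
have b4 : a / 2 <= pi / 4 by lra.
have [c] := @MVT R (@sin R) cos 0 (a/2) b0 (fun z _ => is_derive_sin z)
    (continuous_subspaceT (@continuous_sin R)).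
rewrite in_itv/= sin0 !subr0 => /andP[c0 cb] sE.
have -> : sin a = 2 * sin (a / 2) * cos (a / 2).
  rewrite {1}(_ : a = a / 2 + a / 2); last by field.
  by rewrite sinD; ring.
have h1 : 2^-1 <= cos c ^+ 2 by apply: cos_sqr_ge_half; lra.
have h2 : 2^-1 <= cos (a / 2) ^+ 2 by apply: cos_sqr_ge_half; lra.
have p0 := pi_gt0 R.
have h3 : 0 <= cos c by apply: cos_ge0_pihalf; lra.
have h4 : 0 <= cos (a / 2) by apply: cos_ge0_pihalf; lra.
have h5 : 2^-1 <= cos c * cos (a / 2).
  rewrite -(@ler_pXn2r _ 2) ?nnegrE ?mulr_ge0// exprMn.
  by rewrite expr2 ler_pM.
by rewrite sE; nra.
Qed.

(** With [a = (x-s)/2] and [c = (x+s)/2], the gap is [2 sin c sin a]; here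
    [sin c >= sin a] because [a <= c <= pi - a], and [sin a >= a/2]. *)
Lemma cos_gap_pos s x : 0 <= s -> s <= x -> x <= pi ->
  (x - s) ^+ 2 / 8 <= cos s - cos x.
Proof.
move=> s0 sx xpi.
pose a := (x - s) / 2; pose c := (x + s) / 2.
have p0 := pi_gt0 R.
have -> : cos s = cos (c - a) by congr cos; rewrite /c /a; field.
have -> : cos x = cos (c + a) by congr cos; rewrite /c /a; field.
rewrite cosB cosD.
have ha : a / 2 <= sin a by apply: sin_ge_half; rewrite /a; lra.
have hc : sin a <= sin c.
  have -> : sin c = sin (x / 2 + s / 2) by congr sin; rewrite /c; field.
  have -> : sin a = sin (x / 2 - s / 2) by congr sin; rewrite /a; field.
  rewrite sinB sinD.
  have h1 : 0 <= cos (x / 2) by apply: cos_ge0_pihalf; lra.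
  have h2 : 0 <= sin (s / 2) by apply: sin_ge0_pi; lra.
  have := mulr_ge0 h1 h2; lra.
have a0 : 0 <= a / 2 by rewrite /a; lra.
have : (x - s) ^+ 2 / 8 = 2 * (a / 2) ^+ 2 by rewrite /a; field.
nra.
Qed.

Lemma cos_gap s x : on_path s x -> - pi <= x <= pi ->
  (x - s) ^+ 2 / 8 <= cos s - cos x.
Proof.
move=> /orP[]/andP[h1 h2] /andP[x1 x2]; first exact: cos_gap_pos.
rewrite -(cosN s) -(cosN x) -sqrrN opprB addrC -[s in (- x + s)]opprK.
by apply: cos_gap_pos; lra.
Qed.

End cos_gap.

Section tails.
Context {R : realType} (beta : R).
Hypothesis beta0 : 0 <= beta.
Local Notation leb := (@lebesgue_measure R).
Local Notation p := (gibbs_pdf beta).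
Local Notation b := (Num.sqrt beta).

(** A Lorentzian profile of width of order [1 / sqrt beta].  It dominates the
    Gaussian tails and has an explicit primitive. *)
Definition lorentz (s x : R) : R := (1 + (b * (x - s) / 3) ^+ 2)^-1.

Let b0 : 0 <= b. Proof. exact: sqrtr_ge0. Qed.
Let bb : b ^+ 2 = beta. Proof. exact: sqr_sqrtr. Qed.

Lemma lorentz_den_gt0 (s x : R) : 0 < 1 + (b * (x - s) / 3) ^+ 2.
Proof. by rewrite ltr_pwDl// sqr_ge0. Qed.

Lemma lorentz_ge0 s x : 0 <= lorentz s x.
Proof. by rewrite invr_ge0 ltW// lorentz_den_gt0. Qed.

Lemma lorentz_le1 s x : lorentz s x <= 1.
Proof. by rewrite invf_le1 ?lorentz_den_gt0// lerDl sqr_ge0. Qed.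

Lemma is_derive_scale (c s x : R) :
  is_derive x (1 : R) (fun x => c * (x - s) : R) c.
Proof.
have : is_derive x (1 : R) (c \*: ((id : R -> R^o) - cst s)) (c *: (1 - 0)).
  exact: is_deriveZ.
by rewrite subr0 /GRing.scale/= mulr1.
Qed.

Lemma is_derive_lorentz (s x : R) :
  is_derive x (1 : R) (fun x => 3 * atan (b / 3 * (x - s)) : R) (b * lorentz s x).
Proof.
have d1 := is_derive_scale (b / 3) s x.
have d2 := @is_derive1_comp _ atan (fun x : R => b / 3 * (x - s)) _ _ _
  (is_derive1_atan _) d1.
have d3 := @is_derive1_comp _ (fun y : R => 3 * (y - 0))
  (fun x : R => atan (b / 3 * (x - s))) _ _ _ (is_derive_scale 3 0 _) d2.
rewrite (_ : (fun x => _) =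
  (fun y : R => 3 * (y - 0)) \o (fun x : R => atan (b / 3 * (x - s)))); last first.
  by apply/funext => y /=; rewrite subr0.
apply: (is_derive_eq d3); rewrite /lorentz.
have e : b * (x - s) / 3 = b / 3 * (x - s) by ring.
have := lorentz_den_gt0 s x; rewrite e => h.
have h9 : 0 < 9 + (b * (x - s)) ^+ 2 by rewrite ltr_pwDl// sqr_ge0.
by field; rewrite gt_eqF.
Qed.

Lemma continuous_lorentz s : continuous (lorentz s).
Proof.
move=> x; rewrite /lorentz; apply: cvgV; first by rewrite gt_eqF// lorentz_den_gt0.
apply: cvgD; first exact: cvg_cst.
rewrite expr2; under eq_fun do rewrite expr2.
have h : (fun x : R => b * (x - s) / 3) @ x --> b * (x - s) / 3.
  apply: cvgMr_tmp; apply: cvgMl_tmp; apply: cvgB; [exact: cvg_id|exact: cvg_cst].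
exact: cvgM.
Qed.

Lemma measurable_lorentz s : measurable_fun setT (lorentz s).
Proof. by apply: continuous_measurable_fun; exact: continuous_lorentz. Qed.

Lemma integrable_lorentz (s : R) :
  leb.-integrable `[- pi, pi] (EFin \o lorentz s).
Proof.
apply: continuous_compact_integrable; first exact: segment_compact.
exact/continuous_subspaceT/continuous_lorentz.
Qed.

Definition lorentz_mass (s : R) : R := \int[leb]_(x in `[- pi, pi]) lorentz s x.

Lemma lorentz_mass_ge0 s : 0 <= lorentz_mass s.
Proof. by apply: Rintegral_ge0 => x _; exact: lorentz_ge0. Qed.

Let Npi : - pi < pi :> R.
Proof. by have := pi_gt0 R; lra. Qed.

Lemma lorentz_mass_le s : lorentz_mass s <= 2 * pi.
Proof.
apply: (@le_trans _ _ (\int[leb]_(x in `[- pi, pi]) (cst 1 x))).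
  apply: le_Rintegral => //; first exact: integrable_lorentz.
    apply: continuous_compact_integrable; first exact: segment_compact.
    exact/continuous_subspaceT/cst_continuous.
  by move=> x _; exact: lorentz_le1.
rewrite Rintegral_cst//= lebesgue_measure_itv/= lte_fin Npi -EFinB/= mul1r.
lra.
Qed.

(** The primitive is an arctangent, of total variation at most [pi]. *)
Lemma sqrt_lorentz_mass_le s : b * lorentz_mass s <= 3 * pi.
Proof.
rewrite /lorentz_mass -RintegralZl//; last exact: integrable_lorentz.
rewrite (RFTC2_total Npi (is_derive_lorentz s)); last first.
  by move=> x; apply: cvgMl_tmp; exact: continuous_lorentz.
have := atan_ltpi2 (b / 3 * (pi - s)).
have := atan_gtNpi2 (b / 3 * (- pi - s)).
lra.
Qed.

(** [cos_gap], with 1/8 weakened to 1/9 to have a square inside the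
    exponential. *)
Lemma gibbs_pdf_gauss (s x : R) : on_path s x -> - pi <= x <= pi ->
  p x <= p s * expR (- (b * (x - s) / 3) ^+ 2).
Proof.
move=> sx xpi.
have spi : - pi <= s <= pi.
  by move: sx xpi => /orP[]/andP[h1 h2] /andP[x1 x2]; lra.
rewrite !gibbs_pdfE// mulrAC ler_pM2r ?invr_gt0 ?gibbs_mass_gt0//.
rewrite -expRD ler_expR.
have := cos_gap sx xpi.
rewrite !exprMn bb exprVn.
move: (sqr_ge0 (x - s)) => h0 h.
have : beta * ((x - s) ^+ 2 / 8) <= beta * (cos s - cos x) by rewrite ler_wpM2l.
have : 0 <= beta * (x - s) ^+ 2 by rewrite mulr_ge0.
lra.
Qed.

Lemma expRN_le_lorentz (y : R) : 0 <= y -> expR (- y) <= (1 + y)^-1.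
Proof.
by move=> y0; rewrite expRN lef_pV2 ?posrE ?expR_gt0 ?ltr_pwDl// expR_ge1Dx.
Qed.

Lemma mul_expRN_le (y : R) : 0 <= y -> y * expR (- y) <= 3 * (1 + y)^-1.
Proof.
move=> y0; have y1 : 0 < 1 + y by rewrite ltr_pwDl.
rewrite expRN ler_pdivrMr ?expR_gt0// mulrAC ler_pdivlMr//.
have := @expR_ge1Dxn _ y 1 y0; rewrite (_ : 2`!%:R = 2)//; nra.
Qed.

Lemma gibbs_pdf_lorentz (s x : R) : on_path s x -> - pi <= x <= pi ->
  p x <= p s * lorentz s x.
Proof.
move=> sx xpi; apply: (le_trans (gibbs_pdf_gauss sx xpi)).
by rewrite ler_wpM2l ?gibbs_pdf_ge0// expRN_le_lorentz// sqr_ge0.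
Qed.

(** The weight of the entropy estimate.  A function [psi] with a bounded
    exponential moment may reach the size [beta s^2] on the tail beyond [s],
    a tail of mass [p s / sqrt beta]; as [|s| <= pi], the product of the two
    is at most of order [sqrt beta |s| p s <= slope s * p s]. *)
Definition slope (x : R) : R := 1 + b * `|x|.

Lemma slope_ge1 x : 1 <= slope x.
Proof. by rewrite lerDl mulr_ge0. Qed.

Lemma measurable_slope : measurable_fun setT slope.
Proof.
by apply: measurable_funD => //; apply: measurable_funM => //; exact: measurableT_comp.
Qed.

(** The weight at [x] exceeds the weight at [s] by at most three times the
    square root of the exponent [y] of the Gaussian factor, and [y expR (- y)]
    still decays like a Lorentzian.  The constant is [56 = 2 + 18 * 3]. *)
Lemma slope_sqr_pdf (s x : R) : on_path s x -> - pi <= x <= pi ->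
  slope x ^+ 2 * p x <= 56 * slope s ^+ 2 * p s * lorentz s x.
Proof.
move=> sx xpi.
pose y := (b * (x - s) / 3) ^+ 2.
have y0 : 0 <= y by exact: sqr_ge0.
have h1 : slope x ^+ 2 <= 2 * slope s ^+ 2 + 18 * y.
  have -> : slope x = slope s + b * `|x - s|.
    rewrite /slope -addrA -mulrDr; congr (1 + b * _).
    move: sx => /orP[]/andP[? ?].
      by rewrite !ger0_norm; lra.
    by rewrite !ler0_norm; lra.
  have -> : y = (b * `|x - s|) ^+ 2 / 9.
    by rewrite /y !exprMn real_normK ?num_real//; field.
  have := sqr_ge0 (slope s - b * `|x - s|); lra.
have h2 := gibbs_pdf_gauss sx xpi; rewrite -/y in h2.
have ps := gibbs_pdf_ge0 beta s.
have e1 := expRN_le_lorentz y0.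
have e2 := mul_expRN_le y0.
have s1 := slope_ge1 s.
have l0 := lorentz_ge0 s x; rewrite /lorentz -/y in l0 *.
apply: (@le_trans _ _ ((2 * slope s ^+ 2 + 18 * y) * (p s * expR (- y)))).
  by rewrite ler_pM ?sqr_ge0 ?gibbs_pdf_ge0.
rewrite [leLHS](_ : _ = p s * (2 * slope s ^+ 2 * expR (- y) + 18 * (y * expR (- y)))); last by ring.
rewrite [leRHS](_ : _ = p s * (56 * slope s ^+ 2 * (1 + y)^-1)); last by ring.
rewrite ler_wpM2l//.
have s2 : 1 <= slope s ^+ 2 by rewrite expr_ge1// (le_trans _ s1).
have := ler_wpM2l (_ : 0 <= 2 * slope s ^+ 2) e1.
have := ler_wpM2l (_ : 0 <= 54 * (1 + y)^-1) s2.
move=> /(_ _) A /(_ _) B.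
have := A ltac:(by rewrite mulr_ge0). have := B ltac:(by rewrite mulr_ge0// sqr_ge0).
lra.
Qed.

Local Open Scope ereal_scope.

Lemma tail_le (v : R -> R) (c s : R) : measurable_fun setT v ->
  (forall x, 0 <= v x)%R -> (0 <= c)%R ->
  (forall x, ~~ (- pi <= x <= pi) -> v x = 0)%R ->
  (forall x, on_path s x -> - pi <= x <= pi -> v x <= c * lorentz s x)%R ->
  \int[leb]_x (path_indic s x * v x)%:E <= (c * lorentz_mass s)%:E.
Proof.
move=> mv v0 c0 vout vle.
have mk : measurable_fun setT (path_indic s) by exact: (measurable2_row s measurable2_path_indic).
have mcl : measurable_fun setT (fun x => c * lorentz s x)%R.
  by apply: measurable_funM => //; exact: measurable_lorentz.
apply: (@le_trans _ _ (\int[leb]_(x in `[(- pi)%R, pi]) (c * lorentz s x)%:E)).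
  rewrite [leRHS]integral_mkcond; apply: ge0_le_integral => //.
  - by move=> x _; rewrite lee_fin mulr_ge0// path_indic_ge0.
  - by apply/measurable_EFinP; exact: measurable_funM.
  - apply/(measurable_restrictT _ _).1 => //; apply/measurable_EFinP.
    exact: measurable_funTS.
  - move=> x _; rewrite patchE; case: ifPn => xpi.
      move/set_mem : xpi; rewrite /= in_itv/= => xpi.
      rewrite lee_fin /path_indic; case: ifPn => sx; first by rewrite mul1r vle.
      by rewrite mul0r mulr_ge0// lorentz_ge0.
    rewrite vout ?mulr0//; apply: contra xpi => xpi.
    by apply/mem_set; rewrite /= in_itv.
under eq_integral do rewrite EFinM.
rewrite ge0_integralZl//.
- by rewrite /lorentz_mass /Rintegral EFinM fineK// (integrable_fin_num _ (integrable_lorentz s)).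
- by apply/measurable_EFinP; apply: measurable_funTS; exact: measurable_lorentz.
- by move=> x _; rewrite lee_fin lorentz_ge0.
Qed.

End tails.

(** * Weighted Hardy inequalities for the Gibbs measure *)

Section weighted_hardy.
Context {R : realType} (beta : R).
Hypothesis beta0 : 0 <= beta.
Local Notation leb := (@lebesgue_measure R).
Local Notation p := (gibbs_pdf beta).
Local Notation b := (Num.sqrt beta).
Local Open Scope ereal_scope.

Let mp : measurable_fun setT p. Proof. exact: measurable_gibbs_pdf. Qed.
Let p0 x : (0 <= p x)%R. Proof. exact: gibbs_pdf_ge0. Qed.

Lemma tail_flat (s : R) : (- pi <= s <= pi)%R ->
  \int[leb]_x (path_indic s x * (b ^+ 2 * p x))%:E <= (3 * pi * b * p s)%:E.
Proof.
move=> spi; have c0 : (0 <= b ^+ 2 * p s)%R by rewrite mulr_ge0// sqr_ge0.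
apply: (le_trans (@tail_le _ beta (fun x => b ^+ 2 * p x)%R (b ^+ 2 * p s)%R s _ _ _ _ _)) => //.
- by apply: measurable_funM.
- by move=> x; rewrite mulr_ge0// sqr_ge0.
- by move=> x /gibbs_pdf_out ->; rewrite mulr0.
- move=> x sx xpi; rewrite -[leRHS]mulrA ler_wpM2l ?sqr_ge0//.
  exact: gibbs_pdf_lorentz.
- have := sqrt_lorentz_mass_le beta s.
  rewrite lee_fin => h; rewrite [leLHS](_ : _ = b * p s * (b * lorentz_mass beta s))%R; last by ring.
  rewrite [leRHS](_ : _ = b * p s * (3 * pi))%R; last by ring.
  by rewrite ler_wpM2l// mulr_ge0// sqrtr_ge0.
Qed.

Definition slope_const : R := (56 * (2 * pi + 3 * pi ^+ 2))%R.

(** One factor [slope s] pays for the tail mass: it is [1 + sqrt beta |s|], and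
    the mass is bounded both by [2 pi] and by [3 pi / sqrt beta]. *)
Lemma tail_slope (s : R) : (- pi <= s <= pi)%R ->
  \int[leb]_x (path_indic s x * (slope beta x ^+ 2 * p x))%:E <=
  (slope_const * slope beta s * p s)%:E.
Proof.
move=> spi.
have s1 := slope_ge1 beta s.
have sp : (0 <= slope beta s)%R by rewrite (le_trans _ s1).
have c0 : (0 <= 56 * slope beta s ^+ 2 * p s)%R by apply: mulr_ge0 => //; rewrite mulr_ge0// sqr_ge0.
apply: (le_trans (@tail_le _ beta (fun x => slope beta x ^+ 2 * p x)%R _ s _ _ c0 _ _)) => //.
- by apply: measurable_funM => //; apply: measurable_funX; exact: measurable_slope.
- by move=> x; rewrite mulr_ge0// sqr_ge0.
- by move=> x /gibbs_pdf_out ->; rewrite mulr0.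
- by move=> x sx xpi; exact: slope_sqr_pdf.
- have h1 := sqrt_lorentz_mass_le beta s.
  have h2 := lorentz_mass_le beta s.
  have h : (slope beta s * lorentz_mass beta s <= 2 * pi + 3 * pi ^+ 2)%R.
    rewrite /slope mulrDl mul1r lerD// mulrAC.
    have sa : (`|s| <= pi)%R by rewrite ler_norml.
    rewrite [leRHS](_ : _ = 3 * pi * pi)%R; last by ring.
    by rewrite ler_pM// mulr_ge0 ?sqrtr_ge0// lorentz_mass_ge0.
  rewrite lee_fin /slope_const.
  rewrite [leLHS](_ : _ = 56 * slope beta s * p s * (slope beta s * lorentz_mass beta s))%R; last by ring.
  rewrite [leRHS](_ : _ = 56 * slope beta s * p s * (2 * pi + 3 * pi ^+ 2))%R; last by ring.
  by rewrite ler_wpM2l//; apply: mulr_ge0 => //; rewrite mulr_ge0.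
Qed.

Lemma gibbs_mass_le : (gibbs_mass beta <= 2 * pi * expR beta)%R.
Proof.
have Npi : (- pi < pi :> R)%R by have := pi_gt0 R; lra.
rewrite -lee_fin gibbs_massE gibbs_weight_restrict -integral_mkcond.
apply: (@le_trans _ _ (\int[leb]_(x in `[(- pi)%R, pi]) (cst (expR beta)%:E x))).
  apply: ge0_le_integral => //.
  - apply/measurable_EFinP; apply: measurable_funTS; exact: measurable_gibbs_exp.
  - by move=> x _; rewrite lee_fin ler_expR ler_piMr// cos_le1.
rewrite integral_cst//= lebesgue_measure_itv/= lte_fin Npi -EFinB -EFinM lee_fin.
by rewrite le_eqVlt; apply/orP; left; apply/eqP; ring.
Qed.

(** In [p s = expR (beta cos s) / gibbs_mass beta], bound [cos s] below by
    [1 - s^2 / 2] and the mass above by [2 pi expR beta]. *)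
Lemma expRN_sqr_le_pdf (s : R) : (- pi <= s <= pi)%R ->
  (expR (- (beta * s ^+ 2 / 2)) <= 2 * pi * p s)%R.
Proof.
move=> spi; rewrite gibbs_pdfE// mulrA ler_pdivlMr ?gibbs_mass_gt0//.
apply: (@le_trans _ _ (expR (- (beta * s ^+ 2 / 2)) * (2 * pi * expR beta)))%R.
  by rewrite ler_wpM2l ?expR_ge0// gibbs_mass_le.
rewrite [leLHS](_ : _ = 2 * pi * (expR (- (beta * s ^+ 2 / 2)) * expR beta))%R; last by ring.
rewrite -expRD ler_wpM2l ?mulr_ge0 ?pi_ge0// ler_expR.
have h := cos_ge_quadratic s.
have := ler_wpM2l beta0 h; lra.
Qed.

Definition entropy_const : R := (3 * pi ^+ 2 + 4 * pi)%R.

(** By convexity, [psi <= K + expR (psi - K)] for every [K].  The choice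
    [K = beta s^2 / 2] makes [expR (- K)] at most a multiple of [p s]
    ([expRN_sqr_le_pdf]), so the exponential moment contributes a multiple of
    [p s]; and [K] times the tail mass is of order [|s| sqrt beta]. *)
Lemma tail_entropy (psi : R -> R) (s : R) : measurable_fun setT psi ->
  (forall x, 0 <= psi x)%R -> (- pi <= s <= pi)%R ->
  \int[leb]_x (expR (psi x) * p x)%:E <= 2%:E ->
  \int[leb]_x (path_indic s x * (psi x * p x))%:E <=
  (entropy_const * slope beta s * p s)%:E.
Proof.
move=> mpsi psi0 spi psi2.
pose K := (beta * s ^+ 2 / 2)%R.
have K0 : (0 <= K)%R by rewrite divr_ge0// mulr_ge0// sqr_ge0.
have mk : measurable_fun setT (path_indic s) by exact: (measurable2_row s measurable2_path_indic).
have mkp : measurable_fun setT (fun x => path_indic s x * p x)%R by exact: measurable_funM.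
have mep : measurable_fun setT (fun x => expR (psi x) * p x)%R.
  by apply: measurable_funM => //; exact: measurableT_comp.
have kp0 x : (0 <= path_indic s x * p x)%R by rewrite mulr_ge0// path_indic_ge0.
have ep0 x : (0 <= expR (psi x) * p x)%R by rewrite mulr_ge0// expR_ge0.
apply: (@le_trans _ _ (\int[leb]_x (K%:E * (path_indic s x * p x)%:E +
    (expR (- K))%:E * (expR (psi x) * p x)%:E))).
  apply: ge0_le_integral => //.
  - by move=> x _; rewrite lee_fin mulr_ge0 ?path_indic_ge0// mulr_ge0.
  - by apply/measurable_EFinP; apply: measurable_funM => //; exact: measurable_funM.
  - apply/measurable_EFinP; apply: measurable_funD; exact: measurable_funM.
  - move=> x _; rewrite -!EFinM -EFinD lee_fin.
    have -> : (expR (- K) * (expR (psi x) * p x) = expR (psi x - K) * p x)%R.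
      by rewrite mulrA -expRD addrC.
    have h : (psi x <= K + expR (psi x - K))%R.
      have := expR_ge1Dx (psi x - K); lra.
    have := p0 x => px; have e0 := expR_ge0 (psi x - K).
    rewrite /path_indic; case: ifP => _; last first.
      by rewrite !mul0r mulr0 add0r mulr_ge0.
    by rewrite !mul1r -mulrDl ler_wpM2r.
rewrite ge0_integralD//; last 4 first.
- by move=> x _; rewrite mule_ge0// lee_fin.
- by apply: measurable_funeM; exact/measurable_EFinP.
- by move=> x _; rewrite mule_ge0// lee_fin ?expR_ge0.
- by apply: measurable_funeM; exact/measurable_EFinP.
rewrite ge0_integralZl//; last 2 first.
- exact/measurable_EFinP.
- by move=> x _; rewrite lee_fin.
rewrite ge0_integralZl//; last 2 first.
- exact/measurable_EFinP.
- by move=> x _; rewrite lee_fin.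
have t1 : \int[leb]_x (path_indic s x * p x)%:E <= (p s * lorentz_mass beta s)%:E.
  apply: tail_le => //.
  - by move=> x /gibbs_pdf_out.
  - by move=> x sx xpi; exact: gibbs_pdf_lorentz.
apply: (@le_trans _ _ (K%:E * (p s * lorentz_mass beta s)%:E + (2 * pi * p s)%:E * 2%:E)).
  apply: leeD; first by rewrite lee_wpmul2l.
  apply: lee_pmul => //; first by apply: integral_ge0 => x _; rewrite lee_fin.
  by rewrite lee_fin expRN_sqr_le_pdf.
rewrite -!EFinM -EFinD lee_fin.
have sa : (`|s| <= pi)%R by rewrite ler_norml.
have KJ : (K * lorentz_mass beta s <= 3 * pi ^+ 2 * (b * `|s|))%R.
  have -> : (K * lorentz_mass beta s = (b * `|s|) * (`|s| * (b * lorentz_mass beta s)) / 2)%R.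
    rewrite /K -{1}(sqr_sqrtr beta0) -{1}(real_normK (num_real s)); ring.
  have h1 := sqrt_lorentz_mass_le beta s.
  have h2 : (`|s| * (b * lorentz_mass beta s) <= pi * (3 * pi))%R.
    by rewrite ler_pM// mulr_ge0 ?sqrtr_ge0// lorentz_mass_ge0.
  have h3 : (0 <= b * `|s|)%R by rewrite mulr_ge0// sqrtr_ge0.
  have := ler_wpM2l h3 h2.
  have : (0 <= b * `|s| * (pi * (3 * pi)))%R by rewrite !mulr_ge0// pi_ge0.
  lra.
have b0 : (0 <= b * `|s|)%R by rewrite mulr_ge0// sqrtr_ge0.
rewrite [leLHS](_ : _ = p s * (K * lorentz_mass beta s + 4 * pi))%R; last by ring.
rewrite [leRHS](_ : _ = p s * (entropy_const * slope beta s))%R; last by ring.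
rewrite ler_wpM2l// /entropy_const /slope.
have pi0 := pi_ge0 R.
have : (0 <= 3 * pi ^+ 2 :> R)%R by rewrite mulr_ge0// sqr_ge0.
have : (0 <= 4 * pi * (b * `|s|))%R by rewrite !mulr_ge0// sqrtr_ge0.
lra.
Qed.

End weighted_hardy.

Section hardy_gibbs.
Context {R : realType} (beta : R) (g : R -> R).
Local Notation leb := (@lebesgue_measure R).
Local Notation p := (gibbs_pdf beta).
Local Notation b := (Num.sqrt beta).
Hypothesis gi : leb.-integrable setT (EFin \o g).
Hypothesis gout : forall x, ~~ (- pi <= x <= pi) -> g x = 0.
Local Open Scope ereal_scope.

Local Notation H := (travel g).
Local Notation E := (\int[leb]_x (g x ^+ 2 * p x)%:E).

Hypothesis Efin : E < +oo.

Let mp : measurable_fun setT p. Proof. exact: measurable_gibbs_pdf. Qed.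
Let p0 x : (0 <= p x)%R. Proof. exact: gibbs_pdf_ge0. Qed.
Let mg : measurable_fun setT g.
Proof. by move/measurable_int : gi => /measurable_EFinP. Qed.
Let mH : measurable_fun setT H. Proof. exact: measurable_travel. Qed.
Let H0 x : (0 <= H x)%R. Proof. exact: travel_ge0. Qed.

Let mg2p : measurable_fun setT (fun x => g x ^+ 2 * p x)%R.
Proof. by apply: measurable_funM => //; exact: measurable_funX. Qed.
Let g2p0 x : (0 <= g x ^+ 2 * p x)%R.
Proof. by apply: mulr_ge0 => //; exact: sqr_ge0. Qed.
Let E0 : 0 <= E.
Proof. by apply: integral_ge0 => x _; rewrite lee_fin. Qed.

Section weight.
Variables (q : R -> R).
Hypothesis mq : measurable_fun setT q.
Hypothesis q0 : forall x, (0 <= q x)%R.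

Local Notation X := (\int[leb]_x (H x ^+ 2 * (q x ^+ 2 * p x))%:E).

Let mX : measurable_fun setT (fun x => H x ^+ 2 * (q x ^+ 2 * p x))%R.
Proof.
apply: measurable_funM; first exact: measurable_funX.
by apply: measurable_funM => //; exact: measurable_funX.
Qed.

Let X0 x : (0 <= H x ^+ 2 * (q x ^+ 2 * p x))%R.
Proof. by apply: mulr_ge0; [exact: sqr_ge0|apply: mulr_ge0 => //; exact: sqr_ge0]. Qed.

(** After [hardy_tonelli] the integrand is at most [2 C |g| (H q) p]; as
    [C <= sqrt c1 * sqrt c2], it is at most [(c1 g^2 + c2 (H q)^2) p]. *)
Lemma hardy_step (v : R -> R) (C c1 c2 : R) : measurable_fun setT v ->
  (forall x, 0 <= v x)%R -> (0 <= C)%R -> (0 <= c1)%R -> (0 <= c2)%R ->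
  (C ^+ 2 <= c1 * c2)%R ->
  (forall s, (- pi <= s <= pi)%R ->
     \int[leb]_x (path_indic s x * v x)%:E <= (C * q s * p s)%:E) ->
  \int[leb]_x (H x ^+ 2 * v x)%:E <= c1%:E * E + c2%:E * X.
Proof.
move=> mv v0 C0 c10 c20 Cc tail.
apply: (le_trans (hardy_tonelli gi mv v0)).
rewrite -ge0_integralZl//; last 2 first.
- exact/measurable_EFinP.
- by move=> x _; rewrite lee_fin.
rewrite -ge0_integralZl//; last 2 first.
- exact/measurable_EFinP.
- by move=> x _; rewrite lee_fin.
rewrite -ge0_integralD//; last 4 first.
- by move=> x _; rewrite mule_ge0// lee_fin.
- by apply: measurable_funeM; exact/measurable_EFinP.
- by move=> x _; rewrite mule_ge0// lee_fin.
- by apply: measurable_funeM; exact/measurable_EFinP.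
have mgH : measurable_fun setT (fun s => 2 * `|g s| * H s)%R.
  apply: measurable_funM => //; apply: measurable_funM => //.
  exact: measurableT_comp.
have gH0 s : (0 <= 2 * `|g s| * H s)%R by rewrite mulr_ge0// mulr_ge0.
have mk : measurable2 (fun s x => path_indic s x * v x)%R.
  by apply: measurable2M; [exact: measurable2_path_indic|exact: measurable2_snd].
have k0 s x : (0 <= path_indic s x * v x)%R by rewrite mulr_ge0// path_indic_ge0.
apply: ge0_le_integral => //.
- move=> s _; apply: mule_ge0; first by rewrite lee_fin.
  by apply: integral_ge0 => x _; rewrite lee_fin.
- apply: emeasurable_funM; first exact/measurable_EFinP.
  exact: (measurable_tonelli mk k0).
- apply: emeasurable_funD; apply: measurable_funeM; exact/measurable_EFinP.
- move=> s _; have [spi|spi] := boolP (- pi <= s <= pi)%R; last first.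
    rewrite gout// normr0 mulr0 mul0r mul0e -!EFinM -EFinD lee_fin.
    by rewrite expr0n/= mul0r mulr0 add0r mulr_ge0.
  apply: (@le_trans _ _ ((2 * `|g s| * H s)%:E * (C * q s * p s)%:E)).
    by rewrite lee_wpmul2l ?lee_fin// tail.
  rewrite -!EFinM -EFinD lee_fin.
  have h : (2 * `|g s| * H s * C * q s <= c1 * g s ^+ 2 + c2 * (H s ^+ 2 * q s ^+ 2))%R.
    have -> : (g s ^+ 2 = `|g s| ^+ 2)%R by rewrite real_normK ?num_real.
    pose y := (H s * q s)%R.
    have y0 : (0 <= y)%R by rewrite mulr_ge0.
    rewrite [leLHS](_ : _ = 2 * C * (`|g s| * y))%R; last by rewrite /y; ring.
    rewrite [X in (_ <= _ + c2 * X)%R](_ : _ = y ^+ 2)%R; last by rewrite /y exprMn.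
    set a := `|g s|%R.
    have a0 : (0 <= a)%R by exact: normr_ge0.
    have r1 := sqr_sqrtr c10; have r2 := sqr_sqrtr c20.
    have Cr : (C <= Num.sqrt c1 * Num.sqrt c2)%R.
      rewrite -(@ler_pXn2r _ 2) ?nnegrE ?mulr_ge0 ?sqrtr_ge0//.
      by rewrite exprMn r1 r2.
    have ay : (0 <= a * y)%R by rewrite mulr_ge0.
    have := sqr_ge0 (Num.sqrt c1 * a - Num.sqrt c2 * y)%R.
    have := ler_wpM2r ay Cr.
    rewrite sqrrB !exprMn r1 r2; lra.
  have := ler_wpM2r (p0 s) h; lra.
Qed.

(** With [v = q^2 p] the left side of [hardy_step] is [X] itself; [c2 = 1/2] and
    [c1 = 2 B^2] give [X <= 2 B^2 E + X / 2].  [X] can be subtracted because it is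
    finite: [travel g] is bounded by the integral of [|g|], and [q] is bounded
    on the support of [p]. *)
Lemma hardy_absorb (B Q : R) : (0 <= B)%R ->
  (forall x, - pi <= x <= pi -> q x <= Q)%R ->
  (forall s, (- pi <= s <= pi)%R ->
     \int[leb]_x (path_indic s x * (q x ^+ 2 * p x))%:E <= (B * q s * p s)%:E) ->
  X <= (4 * B ^+ 2)%:E * E.
Proof.
move=> B0 qQ tail.
have mv : measurable_fun setT (fun x => q x ^+ 2 * p x)%R.
  by apply: measurable_funM => //; exact: measurable_funX.
have v0 x : (0 <= q x ^+ 2 * p x)%R.
  by apply: mulr_ge0 => //; exact: sqr_ge0.
have c10 : (0 <= 2 * B ^+ 2)%R by rewrite mulr_ge0// sqr_ge0.
have c12 : (B ^+ 2 <= 2 * B ^+ 2 * 2^-1)%R by rewrite mulrAC mulfV ?mul1r.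
have ih0 : (0 <= 2^-1 :> R)%R by [].
have h := @hardy_step _ B (2 * B ^+ 2) 2^-1 mv v0 B0 c10 ih0 c12 tail.
have Xfin : X \is a fin_num.
  have [A A0 HA] := travel_bound gi.
  apply: integrable_fin_num => //.
  apply: (@le_integrable _ _ _ leb setT measurableT _
     (fun x => (A ^+ 2 * Q ^+ 2)%:E * (p x)%:E)) => //.
  - exact/measurable_EFinP.
  - move=> x _; rewrite -EFinM /= lee_fin ger0_norm// ger0_norm; last first.
      by apply: mulr_ge0 => //; rewrite mulr_ge0// sqr_ge0.
    have [xpi|xpi] := boolP (- pi <= x <= pi)%R; last first.
      by rewrite gibbs_pdf_out// !mulr0.
    rewrite mulrA ler_wpM2r// ler_pM ?sqr_ge0// lerXn2r ?nnegrE//.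
    + exact: (le_trans _ (qQ _ xpi)).
    + exact: qQ.
  - by apply: integrableZl => //; exact: integrable_gibbs_pdf.
have Ef : E \is a fin_num by rewrite ge0_fin_numE.
move: h Xfin Ef; case: (X) => //x; case: (E) => //e + _ _.
rewrite -!EFinM -EFinD !lee_fin; lra.
Qed.

End weight.

Hypothesis beta0 : (0 <= beta)%R.

Lemma gibbs_hardy_poincare :
  \int[leb]_x (H x ^+ 2 * (b ^+ 2 * p x))%:E <= (4 * (3 * pi) ^+ 2)%:E * E.
Proof.
apply: (@hardy_absorb (fun=> b) _ _ (3 * pi)%R b) => //.
- by rewrite mulr_ge0// pi_ge0.
- by move=> s; exact: tail_flat.
Qed.

Definition hardy_const : R := (@entropy_const R * (1 + 4 * @slope_const R ^+ 2))%R.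

(** Two applications of the method with the weight [slope]: a step with
    [v = psi p], then absorption for the term [H^2 slope^2 p] that remains. *)
Lemma gibbs_hardy_entropy (psi : R -> R) : measurable_fun setT psi ->
  (forall x, 0 <= psi x)%R ->
  \int[leb]_x (expR (psi x) * p x)%:E <= 2%:E ->
  \int[leb]_x (H x ^+ 2 * (psi x * p x))%:E <=
  hardy_const%:E * E.
Proof.
move=> mpsi psi0 psi2.
have C0 : (0 <= @entropy_const R)%R by rewrite addr_ge0 ?mulr_ge0 ?pi_ge0.
have B0 : (0 <= @slope_const R)%R.
  by rewrite mulr_ge0// addr_ge0// ?mulr_ge0// ?pi_ge0// exprn_ge0 ?pi_ge0.
have sl0 x : (0 <= slope beta x)%R by rewrite (le_trans _ (slope_ge1 _ _)).
have msl : measurable_fun setT (slope beta) by exact: measurable_slope.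
have hX := @hardy_absorb (slope beta) msl sl0 (@slope_const R) (1 + b * pi)%R B0.
have mv : measurable_fun setT (fun x => psi x * p x)%R by exact: measurable_funM.
have v0 x : (0 <= psi x * p x)%R by apply: mulr_ge0.
apply: (le_trans (@hardy_step (slope beta) msl sl0 _ (@entropy_const R)
  (@entropy_const R) (@entropy_const R) mv v0 C0 C0 C0 _ _)).
- by rewrite expr2.
- by move=> s spi; exact: tail_entropy.
rewrite /hardy_const; move: (@entropy_const R) C0 => C C0.
have CB0 : (0 <= C * (4 * @slope_const R ^+ 2))%R.
  by rewrite mulr_ge0// mulr_ge0// sqr_ge0.
rewrite mulrDr mulr1 EFinD ge0_muleDl ?lee_fin//.
apply: leeD => //; rewrite [leRHS](_ : _ = C%:E *
  ((4 * (@slope_const R) ^+ 2)%:E * E)); last by rewrite EFinM muleA.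
rewrite lee_wpmul2l//; apply: hX.
- move=> x xpi; rewrite lerD2l ler_wpM2l ?sqrtr_ge0// ler_norml//.
- by move=> s spi; exact: tail_slope.
Qed.

End hardy_gibbs.

(** * Sobolev functions as primitives *)

Section H1_facts.
Context {R : realType} (beta : R) (f g : R -> R).
Hypothesis fg : H1 beta f g.
Local Notation leb := (@lebesgue_measure R).
Local Notation mu := (gibbs beta).
Local Notation p := (gibbs_pdf beta).
Local Open Scope ereal_scope.

Lemma U_itv (x : R) : U x <-> (- pi < x < pi)%R.
Proof. by rewrite /U/= in_itv. Qed.

(** For a fixed [beta] the density is bounded below on [U], so
    square-integrability for the Gibbs measure implies Lebesgue integrability. *)
Lemma gibbs_pdf_lb : exists2 M : R, (0 < M)%R & forall x : R, U x -> (1 <= M * p x)%R.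
Proof.
exists (gibbs_mass beta * expR `|beta|)%R.
  by rewrite mulr_gt0 ?gibbs_mass_gt0 ?expR_gt0.
move=> x /U_itv /andP[x1 x2]; rewrite gibbs_pdfE ?(ltW x1) ?(ltW x2)//.
rewrite [leRHS](_ : _ = expR `|beta| * expR (beta * cos x))%R; last first.
  by field; rewrite gt_eqF// gibbs_mass_gt0.
rewrite -expRD -expR0 ler_expR.
have : (`|beta * cos x| <= `|beta|)%R by rewrite normrM ler_piMr// cos_max.
by rewrite ler_norml => /andP[]; lra.
Qed.

Lemma Lfun2_integrable (h : R -> R) : h \_ U \in Lfun mu 2%:E ->
  [/\ measurable_fun setT (h \_ U), \int[leb]_x ((h \_ U) x ^+ 2 * p x)%:E < +oo &
      leb.-integrable setT (EFin \o (h \_ U))].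
Proof.
move=> hL; have mh : measurable_fun setT (h \_ U).
  by move: hL; rewrite inE => /andP[/[!inE]].
have := Lfun2_integrable_sqr hL => /integrableP[_].
under eq_integral do rewrite gee0_abs ?lee_fin ?sqr_ge0//.
rewrite ge0_integral_gibbsT; last 2 first.
- by apply/measurable_EFinP; exact: measurable_funX.
- by move=> x; rewrite lee_fin sqr_ge0.
under eq_integral do rewrite -EFinM.
move=> h2; split => //.
have mp : measurable_fun setT p by exact: measurable_gibbs_pdf.
have p0 x : (0 <= p x)%R by exact: gibbs_pdf_ge0.
have hp0 x : (0 <= (h \_ U) x ^+ 2 * p x)%R.
  by apply: mulr_ge0 => //; exact: sqr_ge0.
have i2 : leb.-integrable setT (EFin \o (fun x => (h \_ U) x ^+ 2 * p x)%R).
  apply/integrableP; split.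
    apply/measurable_EFinP; apply: measurable_funM => //; exact: measurable_funX.
  by under eq_integral do rewrite gee0_abs ?lee_fin ?hp0//.
have [M M0 Mp] := gibbs_pdf_lb.
apply: (@le_integrable _ _ _ leb setT measurableT _
  (fun x => M%:E * ((p x)%:E + ((h \_ U) x ^+ 2 * p x)%:E))).
- exact/measurable_EFinP.
- move=> x _; rewrite -EFinD -EFinM /= lee_fin.
  have M1 : (0 <= M * (p x + (h \_ U) x ^+ 2 * p x))%R.
    by apply: mulr_ge0; [exact: ltW|exact: addr_ge0].
  rewrite [leRHS]ger0_norm//; move: M1.
  rewrite patchE; case: ifPn => xU M1; last by rewrite normr0.
  have Mpx := Mp _ (set_mem xU).
  have : (`|h x| <= 1 + h x ^+ 2)%R.
    have := sqr_ge0 (`|h x| - 1)%R; rewrite sqrrB real_normK ?num_real//.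
    have := sqr_ge0 (h x); lra.
  move=> hx; apply: (le_trans hx).
  rewrite [leRHS](_ : _ = M * p x * (1 + h x ^+ 2))%R; last by ring.
  by rewrite ler_peMl// addr_ge0// sqr_ge0.
- apply: integrableZl => //; apply: integrableD => //.
  exact: integrable_gibbs_pdf.
Qed.

Let f0 := f \_ U.
Let g0 := g \_ U.

Let fi : leb.-integrable setT (EFin \o f0).
Proof. by case: fg => _ /Lfun2_integrable[]. Qed.
Let gi : leb.-integrable setT (EFin \o g0).
Proof. by case: fg => _ _ /Lfun2_integrable[]. Qed.

Lemma H1_test (phi : R -> R) : test_function phi ->
  (\int[leb]_x (f0 x * derive1 phi x) = - \int[leb]_x (g0 x * phi x))%R.
Proof.
move=> tphi; case: fg => -[_ _ /(_ _ tphi) + _ _].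
rewrite Rintegral_mkcond [in RHS]Rintegral_mkcond.
have E (h u : R -> R) : ((fun x => h x * u x)%R \_ U) = (fun x => (h \_ U) x * u x)%R.
  by apply/funext => x; rewrite !patchE; case: ifPn => // _; rewrite mul0r.
by rewrite !E.
Qed.

(** The indicator of the segment joining [0] and [x], with the sign that makes
    [\int_0^x g] the integral of [g s * path_sign s x] over the line. *)
Definition path_sign (s x : R) : R := ((0 < s <= x)%R%:R - (x < s <= 0)%R%:R)%R.

Lemma path_sign_norm s x : (`|path_sign s x| <= path_indic s x)%R.
Proof.
rewrite /path_sign /path_indic /on_path.
by case: (ltrgtP 0%R s); case: (ltrgtP s x) => //= *;
  rewrite ?subrr ?subr0 ?sub0r ?normrN ?normr0 ?normr1//; case: ifP.
Qed.

Lemma measurable_path_sign x : measurable_fun setT (path_sign ^~ x).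
Proof.
rewrite /path_sign; apply: measurable_funB.
  rewrite (_ : (fun _ => _) = \1_(`]0%R, x]%classic)); first exact: measurable_indic.
  by apply/funext => s; rewrite indicE mem_setE in_itv.
rewrite (_ : (fun _ => _) = \1_(`]x, 0%R]%classic)); first exact: measurable_indic.
by apply/funext => s; rewrite indicE mem_setE in_itv.
Qed.

Let mg : measurable_fun setT g0.
Proof. by move/measurable_int : gi => /measurable_EFinP. Qed.

Let path_sign_integrable x : leb.-integrable setT (EFin \o (fun s => g0 s * path_sign s x)%R).
Proof.
apply: (le_integrable measurableT _ _ gi).
  apply/measurable_EFinP; apply: measurable_funM => //; exact: measurable_path_sign.
move=> s _ /=; rewrite lee_fin normrM ler_piMr//.
exact: le_trans (path_sign_norm _ _) (path_indic_le1 _ _).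
Qed.

Let prim (x : R) : R := (\int[leb]_s (g0 s * path_sign s x))%R.

Let prim_le x : (`|prim x| <= travel g0 x)%R.
Proof.
apply: (le_trans (le_normr_Rintegral _ _)) => //.
apply: le_Rintegral => //.
- by have := integrable_norm (path_sign_integrable x).
- exact: travel_integrable.
- by move=> s _; rewrite normrM ler_wpM2l// path_sign_norm.
Qed.

Let primB x1 x2 : (x1 <= x2)%R ->
  (prim x2 - prim x1 = \int[leb]_(s in `]x1, x2]) g0 s)%R.
Proof.
move=> x12; rewrite /prim -RintegralB//.
rewrite [RHS]Rintegral_mkcond; apply: eq_Rintegral => s _.
rewrite -mulrBr patchE mem_setE in_itv/= /path_sign.
have -> : ((0 < s <= x2)%R%:R - (x2 < s <= 0)%R%:R - ((0 < s <= x1)%R%:R - (x1 < s <= 0)%R%:R)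
   = (x1 < s <= x2)%R%:R :> R)%R.
  have [s0|s0] := ltP 0%R s; rewrite ?andbT ?andbF /= ?subr0 ?sub0r.
    have [h|h] := leP s x1; first by rewrite (le_trans h x12) subrr.
    by rewrite subr0.
  have [h|h] := ltP x2 s; first by rewrite (le_lt_trans x12 h) opprK addNr.
  by rewrite oppr0 sub0r opprK; case: ltP.
by case: ifP; rewrite ?mulr1 ?mulr0.
Qed.

(** Fix a Lebesgue point [x0] of [f] in [U].  By [weak_FTC], at every other
    Lebesgue point [f x - f x0] is the increment of the primitive [prim] of the
    weak derivative, so [f] minus that primitive is a constant [a] almost
    everywhere. *)
Lemma H1_travel : exists a : R, {ae leb, forall x, U x -> (`|f x - a| <= travel g0 x)%R}.
Proof.
have ae := lebesgue_differentiation (open_integrable_locally openT fi).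
have f0E x : U x -> f0 x = f x by move=> Ux; rewrite /f0 patchE mem_set.
have [x0 [Ux0 lx0]] : exists x0, U x0 /\ lebesgue_pt f0 x0.
  apply: contrapT => /forallNP noL.
  have [A [mA A0 LA]] := ae.
  have UA : U `<=` A.
    by move=> x Ux; apply: LA => /= lx; apply: (noL x).
  have : leb U <= leb A by apply: le_measure => //; rewrite inE//; exact: measurable_itv.
  rewrite A0 /U /= lebesgue_measure_itv/= lte_fin.
  have p0 := pi_gt0 R.
  have -> : (- pi < pi :> R)%R by lra.
  by rewrite -EFinB lee_fin; lra.
exists (f0 x0 - prim x0)%R.
move: ae; apply: filterS; first exact: (ae_filter_ringOfSetsType leb).
move=> x lx Ux.
have /U_itv/andP[x1 x2] := Ux0.
have /U_itv/andP[y1 y2] := Ux.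
suff -> : (f x - (f0 x0 - prim x0) = prim x)%R by exact: prim_le.
rewrite -f0E//.
have [xx0|xx0] := leP x0 x.
  have := weak_FTC fi gi H1_test x1 xx0 y2 lx0 lx.
  by rewrite -primB//; lra.
have := weak_FTC fi gi H1_test y1 (ltW xx0) x2 lx lx0.
by rewrite -primB ?ltW//; lra.
Qed.

End H1_facts.

(** * A pointwise entropy bound *)

Section ent_pointwise.
Context {R : realType}.

Lemma ln_le_sub1 (x : R) : 0 < x -> ln x <= x - 1.
Proof. by move=> x0; rewrite -ler_expR lnK ?posrE// (le_trans _ (expR_ge1Dx _))//; lra. Qed.

(** With [u = a + h] and [N] the mean of [u^2], the last parenthesis has mean
    [0], so this bounds the entropy of [u^2] by [h^2] and [h^2 ln (1 + h^2 / n)]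
    alone, uniformly in the constant [a].  After replacing [N] by
    [t = a^2 + n], at the cost of that parenthesis, the function
    [u^2 ln (u^2 / t) - u^2 + t] is at most [(u^2 - t)^2 / t], which suffices
    when [h^2 <= t], while [u^2 <= 4 h^2] otherwise.  The number [n] keeps [t]
    positive at [a = 0]. *)
Lemma ent_pointwise (a h n N : R) : 0 < n -> 0 < N ->
  (a + h) ^+ 2 * ln ((a + h) ^+ 2 / N) <=
  15 * (h ^+ 2 + n) + 4 * (h ^+ 2 * ln (1 + h ^+ 2 / n)) +
  ((a ^+ 2 + n) / N * (a + h) ^+ 2 - (a ^+ 2 + n)).
Proof.
move=> n0 N0; set t := a ^+ 2 + n; set f := (a + h) ^+ 2.
have a20 := sqr_ge0 a; have h20 := sqr_ge0 h.
have t0 : 0 < t by rewrite ltr_wpDl.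
have psi0 : 0 <= ln (1 + h ^+ 2 / n).
  by rewrite ln_ge0// lerDl divr_ge0// ltW.
have hpsi0 : 0 <= h ^+ 2 * ln (1 + h ^+ 2 / n) by rewrite mulr_ge0.
have [f0|fn0] := eqVneq f 0.
  have : a + h = 0 by apply/eqP; rewrite -sqrf_eq0 -/f f0.
  move=> /eqP; rewrite addr_eq0 => /eqP ah.
  have : h ^+ 2 = a ^+ 2 by rewrite ah sqrrN.
  by rewrite f0 mul0r mulr0 /t; lra.
have f0 : 0 < f by rewrite lt_neqAle eq_sym fn0 sqr_ge0.
have lnE : ln (f / N) <= ln (f / t) + (t / N - 1).
  rewrite (_ : f / N = f / t * (t / N)); last by field; rewrite !gt_eqF.
  by rewrite lnM ?posrE ?divr_gt0// lerD2l ln_le_sub1// divr_gt0.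
have main : f * ln (f / t) - f + t <= 15 * (h ^+ 2 + n) + 4 * (h ^+ 2 * ln (1 + h ^+ 2 / n)).
  have [ht|ht] := leP (h ^+ 2) t.
    (* the quadratic bound is ln y <= y - 1 at y = f / t *)
    have l1 : f * ln (f / t) - f + t <= (f - t) ^+ 2 / t.
      have h1 : f * ln (f / t) <= f * (f / t - 1).
        by rewrite ler_pM2l// ln_le_sub1// divr_gt0.
      have -> : (f - t) ^+ 2 / t = f * (f / t - 1) - f + t by field; rewrite gt_eqF.
      lra.
    have l2 : (f - t) ^+ 2 / t <= 15 * h ^+ 2 + 3 * n.
      rewrite ler_pdivrMr//.
      have -> : f - t = 2 * (a * h) + h ^+ 2 - n by rewrite /f /t; ring.
      have e1 : (a * h) ^+ 2 <= t * h ^+ 2.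
        by rewrite exprMn ler_wpM2r// /t lerDl ltW.
      have e2 : (h ^+ 2) ^+ 2 <= t * h ^+ 2 by rewrite expr2 ler_wpM2r.
      have e3 : n ^+ 2 <= t * n by rewrite expr2 ler_pM2r// /t lerDr.
      move: e1 e2 e3; move: (a * h) (h ^+ 2) (t) => u w t' e1 e2 e3.
      have := sqr_ge0 (2 * u - w); have := sqr_ge0 (2 * u + n); have := sqr_ge0 (w + n).
      lra.
    lra.
  have f4 : f <= 4 * h ^+ 2.
    have := sqr_ge0 (a - h); rewrite /f /t in ht *; nra.
  have [y1|y1] := leP f t.
    have : ln (f / t) <= 0 by rewrite ln_le0// ler_pdivrMr// mul1r.
    nra.
  have ly0 : 0 <= ln (f / t) by rewrite ln_ge0// ler_pdivlMr// mul1r ltW.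
  have ly : ln (f / t) <= 3 + ln (1 + h ^+ 2 / n).
    have hp : 0 < h ^+ 2 by rewrite (lt_trans t0).
    have l4 : ln (4 : R) <= 3.
      by have := @ln_le_sub1 4 ltac:(lra); lra.
    have z0 : 0 <= h ^+ 2 / n by rewrite divr_ge0// ltW.
    have z1 : 0 < 1 + h ^+ 2 / n by rewrite ltr_pwDl.
    have le4 : f / t <= 4 * (1 + h ^+ 2 / n).
      rewrite ler_pdivrMr//.
      have : h ^+ 2 <= h ^+ 2 / n * t.
        by rewrite -mulrA ler_peMr// mulrC ler_pdivlMr// mul1r /t lerDr.
      lra.
    apply: (@le_trans _ _ (ln (4 * (1 + h ^+ 2 / n)))).
      have ft0 : 0 < f / t by exact: divr_gt0.
      have z4 : 0 < 4 * (1 + h ^+ 2 / n) by exact: mulr_gt0.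
      by rewrite ler_ln ?posrE.
    by rewrite lnM ?posrE// lerD2r.
  have := ler_wpM2r ly0 f4.
  have : 4 * h ^+ 2 * ln (f / t) <= 4 * h ^+ 2 * (3 + ln (1 + h ^+ 2 / n)).
    by rewrite ler_wpM2l// mulr_ge0.
  nra.
have := ler_wpM2l (ltW f0) lnE.
have -> : f * (ln (f / t) + (t / N - 1)) = f * ln (f / t) + (t / N * f - f) by ring.
lra.
Qed.

End ent_pointwise.

Lemma hardy_const_ge0 (R : realType) :
  0 <= @hardy_const R.
Proof.
have p0 := pi_ge0 R; rewrite /hardy_const.
apply: mulr_ge0.
  by rewrite /entropy_const addr_ge0 ?mulr_ge0// exprn_ge0.
by rewrite addr_ge0// mulr_ge0// sqr_ge0.
Qed.

(** * The Poincare and log-Sobolev inequalities *)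

Section gibbs_U.
Context {R : realType} (beta : R).
Local Notation leb := (@lebesgue_measure R).
Local Notation mu := (gibbs beta).
Local Notation p := (gibbs_pdf beta).
Local Open Scope ereal_scope.

Lemma integral_pdf : \int[leb]_x (p x)%:E = 1.
Proof. by rewrite -(@probability_setT _ _ _ (gibbs beta)). Qed.

Lemma integral_gibbs_U (F : R -> R) : measurable_fun U F ->
  (forall x, U x -> 0 <= F x)%R ->
  \int[mu]_(x in U) (F x)%:E = \int[leb]_x ((F \_ U) x * p x)%:E.
Proof.
move=> mF F0; rewrite ge0_integral_gibbs//; last 2 first.
- exact: measurable_U.
- by apply/measurable_EFinP.
- rewrite integral_mkcond; apply: eq_integral => x _.
  rewrite !patchE EFinM; case: ifPn => _ //.
  by rewrite -[RHS]/((0 * p x)%R%:E) mul0r.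
Qed.

(** The positive and the negative parts are compared separately, because the
    entropy integrand is not known in advance to be integrable. *)
Lemma le_integral_any d (T : measurableType d) (m : {measure set T -> \bar R}) (D : set T)
    (F G : T -> \bar R) : measurable D -> measurable_fun D F -> measurable_fun D G ->
  (forall x, D x -> F x <= G x) -> \int[m]_(x in D) F x <= \int[m]_(x in D) G x.
Proof.
move=> mD mF mG FG; rewrite integralE [leRHS]integralE; apply: leeB.
  apply: ge0_le_integral => //; [exact: measurable_funepos..|].
  by move=> x Dx; rewrite !funeposE ge_max le_max FG//= le_max lexx orbT.
apply: ge0_le_integral => //; [exact: measurable_funeneg..|].
by move=> x Dx; rewrite !funenegE ge_max !le_max leeN2 FG//= lexx orbT.
Qed.

Lemma gibbs_setU : mu U = 1.
Proof.
rewrite -integral_pdf /gibbs.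
have -> : U = `](- pi)%R, pi[%classic :> set R by [].
rewrite -(@integral_itv_bndoo R (- pi)%R pi _ true false); last first.
  by apply/measurable_EFinP; apply: measurable_funTS; exact: measurable_gibbs_pdf.
rewrite integral_mkcond; apply: eq_integral => x _; rewrite patchE.
case: ifPn => // xpi; rewrite gibbs_pdf_out//.
by apply: contra xpi => xpi; apply/mem_set; rewrite /= in_itv.
Qed.

End gibbs_U.

Section upper.
Context {R : realType} (beta : R) (f g : R -> R).
Hypothesis fg : H1 beta f g.
Local Notation leb := (@lebesgue_measure R).
Local Notation mu := (gibbs beta).
Local Notation p := (gibbs_pdf beta).
Local Open Scope ereal_scope.
Local Notation I F := (\int[mu]_(x in U) (F x))%R.
Local Notation H := (travel (g \_ U)).

Lemma Lfun2_restrict (h : R -> R) : h \_ U \in Lfun mu 2%:E ->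
  [/\ measurable_fun U h, mu.-integrable U (EFin \o (fun x => h x ^+ 2)%R) &
      mu.-integrable U (EFin \o h)].
Proof.
move=> hL; have mh : measurable_fun setT (h \_ U).
  by move: hL; rewrite inE => /andP[/[!inE]].
have mUh : measurable_fun U h by exact: ((measurable_restrictT h (@measurable_U R)).2 mh).
have i2 : mu.-integrable U (EFin \o (fun x => h x ^+ 2)%R).
  apply/(integrable_mkcond _ (measurable_U (R:=R))).
  have := Lfun2_integrable_sqr hL; apply: eq_integrable => //.
  move=> x _; rewrite /= !patchE; case: ifPn => // _.
  by rewrite expr0n.
split => //.
have mu1 : mu.-integrable U (EFin \o cst 1%R).
  by apply: finite_measure_integrable_cst; exact: measurable_U.
apply: (le_integrable (measurable_U (R:=R)) _ _ (integrableD (measurable_U (R:=R)) mu1 i2)).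
  exact/measurable_EFinP.
move=> x _ /=; rewrite lee_fin [leRHS]ger0_norm ?addr_ge0 ?sqr_ge0//.
have := sqr_ge0 (`|h x| - 1)%R; rewrite sqrrB real_normK ?num_real//.
have := sqr_ge0 (h x); lra.
Qed.

Lemma energyE : energy beta g = \int[leb]_x ((g \_ U) x ^+ 2 * p x)%:E.
Proof.
have [_ _ /Lfun2_restrict[mg _ _]] := fg.
rewrite /energy integral_gibbs_U//.
- by apply: eq_integral => x _; rewrite !patchE; case: ifPn => // _; rewrite expr0n.
- exact: measurable_funX.
- by move=> x _; exact: sqr_ge0.
Qed.

Lemma energy_lty : energy beta g < +oo.
Proof. by rewrite energyE; case: fg => _ _ /Lfun2_integrable[]. Qed.

Let gi : leb.-integrable setT (EFin \o (g \_ U)).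
Proof. by case: fg => _ _ /Lfun2_integrable[]. Qed.

Let gout (x : R) : ~~ (- pi <= x <= pi)%R -> (g \_ U) x = 0%R.
Proof.
move=> xpi; rewrite patchE memNset//; apply: contraNnot xpi => /U_itv/andP[x1 x2].
by rewrite !ltW.
Qed.

Lemma weighted_le (a : R) (psi : R -> R) :
  {ae leb, forall x, U x -> (`|f x - a| <= H x)%R} ->
  measurable_fun setT psi -> (forall x, 0 <= psi x)%R ->
  \int[mu]_(x in U) ((f x - a) ^+ 2 * psi x)%:E <=
  \int[leb]_x (H x ^+ 2 * (psi x * p x))%:E.
Proof.
move=> fH mpsi psi0.
have [_ /Lfun2_restrict[mf _ _] _] := fg.
have mp : measurable_fun setT p by exact: measurable_gibbs_pdf.
have p0 x : (0 <= p x)%R by exact: gibbs_pdf_ge0.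
have mh : measurable_fun U (fun x => (f x - a) ^+ 2 * psi x)%R.
  apply: measurable_funM; last exact: measurable_funTS.
  by apply: measurable_funX; exact: measurable_funB.
have h0 x : (0 <= (f x - a) ^+ 2 * psi x)%R by rewrite mulr_ge0// sqr_ge0.
have mUU : measurable (U : set R) by exact: measurable_U.
rewrite integral_gibbs_U//.
have mHT := measurable_travel gi.
apply: ae_ge0_le_integral => //.
- move=> x _; rewrite lee_fin; apply: mulr_ge0 => //.
  by rewrite patchE; case: ifP.
- apply/measurable_EFinP; apply: measurable_funM => //.
  by exact: ((measurable_restrictT _ mUU).1 mh).
- move=> x _; rewrite lee_fin; apply: mulr_ge0; first exact: sqr_ge0.
  exact: mulr_ge0.
- apply/measurable_EFinP; apply: measurable_funM; first exact: measurable_funX.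
  exact: measurable_funM.
- move: fH; apply: filterS; first exact: (ae_filter_ringOfSetsType leb).
  move=> x Hx _; rewrite lee_fin patchE; case: ifPn => xU; last first.
    by rewrite mul0r; apply: mulr_ge0; [exact: sqr_ge0|exact: mulr_ge0].
  rewrite mulrA ler_wpM2r// ler_wpM2r//.
  by rewrite -(real_normK (num_real (f x - a))) lerXn2r ?nnegrE// ?Hx ?travel_ge0//; exact: set_mem.
Qed.

Hypothesis beta0 : (0 <= beta)%R.

Let mUU : measurable (U : set R). Proof. exact: measurable_U. Qed.

Let mf : measurable_fun U f.
Proof. by have [_ /Lfun2_restrict[]] := fg. Qed.
Let if2 : mu.-integrable U (EFin \o (fun x => f x ^+ 2)%R).
Proof. by have [_ /Lfun2_restrict[]] := fg. Qed.
Let if1 : mu.-integrable U (EFin \o f).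
Proof. by have [_ /Lfun2_restrict[]] := fg. Qed.
Let ic (c : R) : mu.-integrable U (EFin \o cst c).
Proof. exact: finite_measure_integrable_cst. Qed.

Let I_cst (c : R) : I (cst c) = c.
Proof. by rewrite Rintegral_cst//= gibbs_setU/= mulr1. Qed.

Let ih2 (a : R) : mu.-integrable U (EFin \o (fun x => (f x - a) ^+ 2)%R).
Proof.
have := integrableD mUU (integrableB mUU if2 (integrableZl mUU (2 * a) if1)) (ic (a ^+ 2)).
apply: eq_integrable => // x _ /=.
by congr EFin; ring.
Qed.

Let I_h2 (a : R) : I (fun x => (f x - a) ^+ 2)%R =
  (I (fun x => f x ^+ 2)%R - 2 * a * I f + a ^+ 2)%R.
Proof.
rewrite -[X in _ = (_ + X)%R](I_cst (a ^+ 2)) -RintegralZl// -RintegralB//; last first.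
  exact: (integrableZl mUU (2 * a) if1).
rewrite -RintegralD//; last first.
  by have := integrableB mUU if2 (integrableZl mUU (2 * a) if1).
by apply: eq_Rintegral => x _ /=; ring.
Qed.

Let EI (F : R -> R) : mu.-integrable U (EFin \o F) ->
  \int[mu]_(x in U) (F x)%:E = (I F)%:E.
Proof. by move=> iF; rewrite /Rintegral fineK//; exact: integrable_fin_num iF. Qed.

(** The variance is the least mean square distance to a constant. *)
Lemma var_le (a : R) : var beta f <= (I (fun x => (f x - a) ^+ 2)%R)%:E.
Proof.
rewrite /var EI// EI// I_h2 -EFin_expe -EFinB lee_fin.
have := sqr_ge0 (I f - a)%R; rewrite sqrrB; lra.
Qed.

Lemma gibbs_poincare : (0 < beta)%R ->
  var beta f <= (4 * (3 * pi) ^+ 2 / beta)%:E * energy beta g.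
Proof.
move=> beta_gt0; have [a fH] := H1_travel fg.
apply: (le_trans (var_le a)).
have := weighted_le fH (measurable_cst beta) (fun=> beta0).
have := @gibbs_hardy_poincare R beta (g \_ U) gi gout.
rewrite -energyE => /(_ energy_lty beta0).
rewrite sqr_sqrtr// => h1 h2; have := le_trans h2 h1.
rewrite (eq_integral (fun x => beta%:E * ((f x - a) ^+ 2)%:E)); last first.
  by move=> x _; rewrite -EFinM mulrC.
rewrite ge0_integralZl//; last 2 first.
- by apply/measurable_EFinP; apply: measurable_funX; exact: measurable_funB.
- by move=> x _; rewrite lee_fin sqr_ge0.
rewrite EI// => h3.
rewrite EFinM muleAC lee_pdivlMr// muleC; exact: h3.
Qed.

(** [psi = ln (1 + (f - a)^2 / n)] is admissible in [gibbs_hardy_entropy]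
    because [expR psi] has mean [1 + \int (f - a)^2 / n <= 2]. *)
Lemma gibbs_entropy_le (a n : R) : (0 < n)%R ->
  (I (fun x => (f x - a) ^+ 2)%R <= n)%R ->
  {ae leb, forall x, U x -> (`|f x - a| <= H x)%R} ->
  ent beta f <= (30 * n)%:E +
   (4 * @hardy_const R)%:E * energy beta g.
Proof.
move=> n0 hn fH.
set C := @hardy_const R.
have C0 : (0 <= C)%R by exact: hardy_const_ge0.
have E0 : 0 <= energy beta g by apply: integral_ge0 => x _; rewrite lee_fin sqr_ge0.
have RHS0 : 0 <= (30 * n)%:E + (4 * C)%:E * energy beta g.
  apply: adde_ge0; first by rewrite lee_fin mulr_ge0// ltW.
  by apply: mule_ge0 => //; rewrite lee_fin mulr_ge0.
have N0 : (0 <= sqnorm beta f)%R by apply: Rintegral_ge0 => x _; exact: sqr_ge0.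
have [N00|Nn0] := eqVneq (sqnorm beta f) 0%R.
  rewrite /ent N00 (eq_integral (cst 0)) ?integral0//.
  by move=> x _; rewrite invr0 mulr0 ln0// mulr0.
have {}N0 : (0 < sqnorm beta f)%R by rewrite lt_neqAle eq_sym Nn0.
set N := sqnorm beta f in N0 Nn0.
pose h2 := (fun x => (f x - a) ^+ 2)%R \_ U.
have mhU : measurable_fun U (fun x => (f x - a) ^+ 2)%R.
  by apply: measurable_funX; exact: measurable_funB.
have mh2 : measurable_fun setT h2 by exact: ((measurable_restrictT _ mUU).1 mhU).
have h20 x : (0 <= h2 x)%R by rewrite /h2 patchE; case: ifP => // _; exact: sqr_ge0.
pose psi x := ln (1 + h2 x / n).
have psi0 x : (0 <= psi x)%R.
  by rewrite ln_ge0// lerDl divr_ge0// ltW.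
have mpsi : measurable_fun setT psi.
  apply: measurableT_comp => //; apply: measurable_funD => //.
  exact: measurable_funM.
have psi2 : \int[leb]_x (expR (psi x) * p x)%:E <= 2%:E.
  have -> : \int[leb]_x (expR (psi x) * p x)%:E =
      \int[leb]_x ((p x)%:E + n^-1%:E * (h2 x * p x)%:E).
    apply: eq_integral => x _; rewrite lnK; last first.
      by rewrite posrE ltr_pwDl// divr_ge0// ltW.
    by rewrite -EFinM -EFinD; congr EFin; ring.
  have mp : measurable_fun setT p by exact: measurable_gibbs_pdf.
  have p0 x : (0 <= p x)%R by exact: gibbs_pdf_ge0.
  have hp0 x : (0 <= h2 x * p x)%R by exact: mulr_ge0.
  have mh2p : measurable_fun setT (fun x => h2 x * p x)%R by exact: measurable_funM.
  rewrite ge0_integralD//; last 4 first.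
  - by move=> x _; rewrite lee_fin.
  - exact/measurable_EFinP.
  - move=> x _; apply: mule_ge0; last by rewrite lee_fin.
    by rewrite lee_fin invr_ge0 ltW.
  - by apply: measurable_funeM; exact/measurable_EFinP.
  rewrite integral_pdf ge0_integralZl//; last 3 first.
  - exact/measurable_EFinP.
  - by move=> x _; rewrite lee_fin.
  - by rewrite lee_fin invr_ge0 ltW.
  rewrite -(integral_gibbs_U _ mhU); last by move=> x _; exact: sqr_ge0.
  rewrite EI// -EFinM -EFinD lee_fin.
  have : (n^-1 * I (fun x => (f x - a) ^+ 2) <= 1)%R.
    by rewrite mulrC ler_pdivrMr// mul1r.
  lra.
have S := @gibbs_hardy_entropy R beta (g \_ U) gi gout.
rewrite -energyE in S.
have {}S := le_trans (weighted_le fH mpsi psi0) (S energy_lty beta0 psi mpsi psi0 psi2).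
have hpsi0 x : (0 <= (f x - a) ^+ 2 * psi x)%R by rewrite mulr_ge0// sqr_ge0.
have mhpsi : measurable_fun U (fun x => (f x - a) ^+ 2 * psi x)%R.
  apply: measurable_funM; last exact: measurable_funTS.
  by apply: measurable_funX; exact: measurable_funB.
have ihpsi : mu.-integrable U (EFin \o (fun x => (f x - a) ^+ 2 * psi x)%R).
  apply/integrableP; split; first exact/measurable_EFinP.
  under eq_integral do rewrite gee0_abs ?lee_fin//.
  by rewrite (le_lt_trans S)// lte_mul_pinfty ?lee_fin ?energy_lty.
pose t := (a ^+ 2 + n)%R.
pose G1 x := (15 * ((f x - a) ^+ 2 + n) + 4 * ((f x - a) ^+ 2 * psi x))%R.
pose G2 x := (t / N * f x ^+ 2 - t)%R.
have iG1a : mu.-integrable U (EFin \o (fun x => 15 * ((f x - a) ^+ 2 + n))%R).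
  have := integrableZl mUU 15%R (integrableD mUU (ih2 a) (ic n)).
  by apply: eq_integrable => // x _ /=; rewrite -EFinD -EFinM.
have iG1b : mu.-integrable U (EFin \o (fun x => 4 * ((f x - a) ^+ 2 * psi x))%R).
  exact: (integrableZl mUU 4%R ihpsi).
have iG1 : mu.-integrable U (EFin \o G1) by exact: (integrableD mUU iG1a iG1b).
have iG2a := integrableZl mUU (t / N)%R if2.
have iG2 : mu.-integrable U (EFin \o G2) by exact: (integrableB mUU iG2a (ic t)).
have IG2 : I G2 = 0%R.
  rewrite /G2 RintegralB//; last exact: ic.
  rewrite RintegralZl// I_cst -/N /N /sqnorm -/(sqnorm beta f) mulfVK// subrr//.
have IG1 : I G1 = (15 * (I (fun x => (f x - a) ^+ 2) + n) +
    4 * I (fun x => (f x - a) ^+ 2 * psi x))%R.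
  rewrite /G1 RintegralD// RintegralZl//; last by exact: (integrableD mUU (ih2 a) (ic n)).
  by rewrite RintegralD//; [rewrite I_cst RintegralZl|exact: ic].
apply: (@le_trans _ _ (\int[mu]_(x in U) (G1 x + G2 x)%:E)).
  apply: le_integral_any => //.
  - apply/measurable_EFinP; apply: measurable_funM; first exact: measurable_funX.
    apply: measurableT_comp => //.
    by apply: measurable_funM => //; exact: measurable_funX.
  - apply/measurable_EFinP; apply: measurable_funD.
      by move/measurable_int : iG1 => /measurable_EFinP.
    by move/measurable_int : iG2 => /measurable_EFinP.
  - move=> x Ux; rewrite lee_fin.
    have := @ent_pointwise R a (f x - a) n N n0 N0.
    rewrite addrC subrK /G1 /G2 /psi /h2 patchE mem_set//.
rewrite EI; last by exact: (integrableD mUU iG1 iG2).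
rewrite RintegralD// IG2 addr0 IG1 EFinD; apply: leeD.
  by rewrite lee_fin; lra.
rewrite EFinM EFinM -muleA lee_wpmul2l// -EI//.
Qed.

(** The constant function [psi = ln 2] is admissible too, and shows that
    [\int (f - a)^2] is at most [hardy_const / ln 2] times the energy; this is
    the size of [n] to use in [gibbs_entropy_le]. *)
Lemma gibbs_log_sobolev :
  ent beta f <= ((34 + 30 / ln 2) * @hardy_const R)%:E * energy beta g.
Proof.
have [a fH] := H1_travel fg.
set C := @hardy_const R.
have C0 : (0 <= C)%R by exact: hardy_const_ge0.
have ln20 : (0 < ln 2 :> R)%R by rewrite -expR_gt1 lnK ?posrE//; lra.
have S := @gibbs_hardy_entropy R beta (g \_ U) gi gout.
rewrite -energyE in S.
have {}S := S energy_lty beta0 (cst (ln 2)) (measurable_cst _) (fun=> ltW ln20).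
have := le_trans (weighted_le fH (measurable_cst (ln 2)) (fun=> ltW ln20)) (S _).
have -> : \int[leb]_x (expR (cst (ln 2) x) * p x)%:E = 2%:E.
  rewrite /= lnK ?posrE//.
  under eq_integral do rewrite EFinM.
  rewrite ge0_integralZl//; last 2 first.
  - by apply/measurable_EFinP; exact: measurable_gibbs_pdf.
  - by move=> x _; rewrite lee_fin gibbs_pdf_ge0.
  by rewrite integral_pdf mule1.
move=> /(_ (lexx _)).
rewrite (eq_integral (fun x => (ln 2)%:E * ((f x - a) ^+ 2)%:E)); last first.
  by move=> x _; rewrite -EFinM mulrC.
rewrite ge0_integralZl//; last 3 first.
- by apply/measurable_EFinP; apply: measurable_funX; exact: measurable_funB.
- by move=> x _; rewrite lee_fin sqr_ge0.
- by rewrite lee_fin ltW.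
rewrite EI//.
have Efin : energy beta g \is a fin_num.
  rewrite ge0_fin_numE ?energy_lty//.
  by apply: integral_ge0 => x _; rewrite lee_fin sqr_ge0.
have E0 : 0 <= energy beta g by apply: integral_ge0 => x _; rewrite lee_fin sqr_ge0.
have key := @gibbs_entropy_le a _ _ _ fH.
move: Efin E0 key; case: (energy beta g) => // e _.
rewrite -!EFinM lee_fin => e0 key; rewrite lee_fin => hn.
(* n must be positive even if the energy vanishes: add d / 30, then let d
   tend to 0 *)
apply/lee_addgt0Pr => d d0.
set v := I (fun x => (f x - a) ^+ 2)%R in hn key.
have n0 : (0 < v + d / 30)%R.
  by rewrite ltr_wpDl ?divr_gt0//; apply: Rintegral_ge0 => x _; exact: sqr_ge0.
have vn : (v <= v + d / 30)%R by rewrite lerDl ltW// divr_gt0.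
apply: (le_trans (key _ n0 vn)).
rewrite -!EFinD lee_fin.
have : (v <= C * e / ln 2)%R by rewrite ler_pdivlMr// mulrC.
rewrite -/C.
have -> : ((34 + 30 / ln 2) * C * e = 34 * (C * e) + 30 * (C * e / ln 2))%R by ring.
have : (0 <= C * e)%R by rewrite mulr_ge0.
lra.
Qed.

End upper.

(** * Functions that bound the log-Sobolev constant from below *)

Section C1_functions.
Context {R : realType} (beta : R).
Local Notation leb := (@lebesgue_measure R).
Local Notation mu := (gibbs beta).
Local Notation J G := (\int[leb]_(x in `[- pi, pi]) (G x)).

Let Npi : - pi < pi :> R.
Proof. by have := pi_gt0 R; lra. Qed.

Lemma continuous_segment_integrable (G : R -> R) (a b : R) : continuous G ->
  leb.-integrable `[a, b] (EFin \o G).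
Proof.
move=> cG; apply: continuous_compact_integrable; first exact: segment_compact.
exact: continuous_subspaceT.
Qed.

Lemma continuous_locally_integrable (F : R -> R) : continuous F ->
  locally_integrable U F.
Proof.
move=> cF; split.
- by apply: measurable_funTS; exact: continuous_measurable_fun.
- exact: itv_open.
- move=> K _ cK.
  have := continuous_compact_integrable cK (continuous_subspaceT cF).
  by move=> /integrableP[].
Qed.

Lemma Rintegral_U (F : R -> R) : continuous F ->
  \int[leb]_(x in U) F x = J F.
Proof.
move=> cF; rewrite /Rintegral; congr fine.
rewrite (@integral_itv_bndoo R (- pi) pi _ true false)//.
apply/measurable_EFinP; apply: measurable_funTS; exact: continuous_measurable_fun.
Qed.

Lemma continuous_Lfun (F : R -> R) : continuous F -> F \_ U \in Lfun mu 2%:E.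
Proof.
move=> cF.
have mF : measurable_fun setT (F \_ U).
  apply: ((measurable_restrictT _ (@measurable_U R)).1 _).
  by apply: measurable_funTS; exact: continuous_measurable_fun.
have [M M0 FM] : exists2 M : R, 0 <= M & forall x, `|(F \_ U) x| <= M.
  have cF2 : {within `[- pi, pi], continuous (fun x => `|F x|)}.
    by apply: continuous_subspaceT => x; apply: cvg_norm; exact: cF.
  have [c _ Fc] := @EVT_max R (fun x => `|F x|) _ _ (ltW Npi) cF2.
  exists `|F c| => // x; rewrite patchE; case: ifPn => [|_]; last by rewrite normr0.
  move=> /set_mem/U_itv/andP[x1 x2].
  by apply: Fc; rewrite in_itv/= !ltW.
rewrite inE; apply/andP; split; rewrite inE//=.
rewrite /finite_norm unlock /Lnorm poweR_lty//.
apply: (@le_lt_trans _ _ (\int[mu]_x (cst (M `^ 2)%:E x))%E).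
  apply: ge0_le_integral => //.
  - by move=> x _; rewrite lee_fin powR_ge0.
  - apply/measurable_EFinP.
    apply/(@measurableT_comp _ _ _ _ _ _ (fun x : R => x `^ 2)%R) => //.
    exact/measurableT_comp.
  - by move=> x _; rewrite lee_fin ge0_ler_powR// ?nnegrE.
have mu1 : mu setT = 1%E by exact: probability_setT.
rewrite integral_cst// [X in (_ * X)%E](_ : _ = 1%E) ?mule1 ?ltry//.
Qed.

Lemma test_bnd (phi : R -> R) x : test_function phi -> ~ U x -> phi x = 0.
Proof.
move=> [_ _ supp] nU; apply: contrapT => /eqP px; apply: nU; apply: supp.
exact: subset_closure.
Qed.

Lemma continuousM_fun (u v : R -> R) : continuous u -> continuous v ->
  continuous (fun x => u x * v x).
Proof. by move=> cu cv x; apply: cvgM; [exact: cu|exact: cv]. Qed.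

Lemma continuousD_fun (u v : R -> R) : continuous u -> continuous v ->
  continuous (fun x => u x + v x).
Proof. by move=> cu cv x; apply: cvgD; [exact: cu|exact: cv]. Qed.

(** The boundary terms of the integration by parts vanish with the test
    function. *)
Lemma C1_H1 (F dF : R -> R) : (forall x, is_derive x (1 : R) F (dF x)) ->
  continuous dF -> H1 beta F dF.
Proof.
move=> d cdF; have cF := is_derive_continuous d.
split; [split|exact: continuous_Lfun|exact: continuous_Lfun].
- exact: continuous_locally_integrable.
- exact: continuous_locally_integrable.
- move=> phi tphi; have [sm _ _] := tphi.
  have dphi x : is_derive x (1 : R) phi (derive1 phi x).
    by rewrite derive1E; apply: derivableP; exact: (sm 0%N x).
  have cphi := is_derive_continuous dphi.
  have cdphi : continuous (derive1 phi).
    by move=> x; apply/differentiable_continuous/derivable1_diffP; exact: (sm 1%N x).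
  rewrite Rintegral_U; last exact: continuousM_fun.
  rewrite Rintegral_U; last exact: continuousM_fun.
  have dLR (u du : R -> R) : (forall x, is_derive x (1 : R) u (du x)) ->
      derivable_oo_LRcontinuous u (- pi) pi.
    move=> du'; have cu := is_derive_continuous du'; split.
    + by move=> x _; have [] := du' x.
    + exact/cvg_at_right_filter/cu.
    + exact/cvg_at_left_filter/cu.
  have d1E (u du : R -> R) : (forall x, is_derive x (1 : R) u (du x)) ->
      {in `]- pi, pi[, derive1 u =1 du}.
    by move=> du' x _; rewrite derive1E; exact: (@derive_val _ _ _ _ _ _ _ (du' x)).
  rewrite (Rintegration_by_parts Npi (continuous_subspaceT cdF) (dLR _ _ d) (d1E _ _ d)
    (continuous_subspaceT cdphi) (dLR _ _ dphi) (d1E _ _ dphi)).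
  have nU (x : R) : x = pi \/ x = - pi -> ~ U x.
    by move=> xpi /U_itv; case: xpi => ->; rewrite ltxx ?andbF.
  rewrite (test_bnd tphi (nU _ (or_introl erefl))).
  by rewrite (test_bnd tphi (nU _ (or_intror erefl))) !mulr0 subrr sub0r.
Qed.

Lemma integral_gibbs_cont (F : R -> R) : continuous F ->
  (\int[mu]_(x in U) (F x)%:E =
   ((gibbs_mass beta)^-1 * J (fun x => F x * expR (beta * cos x)))%:E)%E.
Proof.
move=> cF; rewrite integral_gibbs_itv; last exact: continuous_measurable_fun.
have cFe : continuous (fun x => F x * expR (beta * cos x)).
  by move=> x; apply: cvgM; [exact: cF|exact: continuous_gibbs_exp].
rewrite -RintegralZl//; last exact: continuous_segment_integrable.
have cZ : continuous (fun x => (gibbs_mass beta)^-1 * (F x * expR (beta * cos x))).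
  by move=> x; apply: cvgMl_tmp; exact: cFe.
rewrite /Rintegral fineK.
  by apply: eq_integral => x _; congr EFin; ring.
have := @continuous_segment_integrable _ (- pi) pi cZ.
by move=> /integrable_fin_num; apply.
Qed.

End C1_functions.

Section lower.
Context {R : realType}.
Local Notation leb := (@lebesgue_measure R).
Local Notation J G := (\int[leb]_(x in `[- pi, pi]) (G x)).

Let Npi : - pi < pi :> R.
Proof. by have := pi_gt0 R; lra. Qed.

Lemma is_derive_expcos (c x : R) : is_derive x (1 : R)
  (fun x => expR (c * cos x)) (- c * sin x * expR (c * cos x)).
Proof.
have d1 : is_derive x (1 : R) (fun x => c * cos x) (c * - sin x).
  apply: (is_derive_eq (is_deriveM (is_derive_cst c x (1 : R)) (is_derive_cos x))).
  by rewrite /GRing.scale/=; ring.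
apply: (is_derive_eq (@is_derive1_comp _ expR (fun x : R => c * cos x) _ _ _
  (is_derive_expR _) d1)).
by ring.
Qed.

Let cexp (c : R) : continuous (fun x : R => expR (c * cos x)).
Proof. exact: continuous_gibbs_exp. Qed.

Let ccst (c : R) : continuous (fun _ : R => c).
Proof. by move=> x; exact: cvg_cst. Qed.

Let J_Z (c : R) (G : R -> R) : continuous G -> J (fun x => c * G x) = c * J G.
Proof. by move=> cG; rewrite RintegralZl//; exact: continuous_segment_integrable. Qed.

Let J_D (F G : R -> R) : continuous F -> continuous G ->
  J (fun x => F x + G x) = J F + J G.
Proof.
by move=> cF cG; rewrite RintegralD//; exact: continuous_segment_integrable.
Qed.

Lemma gibbs_mass_J (beta : R) : gibbs_mass beta = J (fun x => expR (beta * cos x)).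
Proof.
apply: EFin_inj; rewrite gibbs_massE gibbs_weight_restrict -integral_mkcond.
rewrite /Rintegral fineK//.
have := @continuous_segment_integrable R _ (- pi) pi (@cexp beta).
by move=> /integrable_fin_num; apply.
Qed.

Let shift_pi (G : R -> R) : continuous G ->
  \int[leb]_(x in `[0, pi]) G x = \int[leb]_(x in `[- pi, 0]) G (x + pi).
Proof.
move=> cG.
have dF (x : R) : is_derive x (1 : R) (fun x => x + pi) 1.
  have := is_deriveD (is_derive_id x (1 : R)) (is_derive_cst (pi : R) x (1 : R)).
  by rewrite addr0.
have F'1 : derive1 (fun x : R => x + pi) = cst 1.
  by apply/funext => x; rewrite derive1E; exact: (@derive_val _ _ _ _ _ _ _ (dF x)).
have cF := is_derive_continuous dF.
have p0 := pi_gt0 R.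
have := @integration_by_substitution_increasing R (fun x => x + pi) G (- pi) 0.
rewrite F'1 addNr add0r => /(_ _ _ _ _ _ _ _) H.
rewrite /Rintegral H//.
- by congr fine; apply: eq_integral => x _; rewrite /= mulr1.
- by lra.
- by move=> x y _ _ xy; rewrite ltrD2r.
- by move=> x _; exact: cst_continuous.
- exact: is_cvg_cst.
- exact: is_cvg_cst.
- split.
  + by move=> x _; have [] := dF x.
  + exact/cvg_at_right_filter/cF.
  + exact/cvg_at_left_filter/cF.
- exact: continuous_subspaceT.
Qed.

Let J_split (G : R -> R) : continuous G ->
  J G = \int[leb]_(x in `[- pi, 0]) G x + \int[leb]_(x in `[0, pi]) G x.
Proof.
move=> cG; have p0 := pi_gt0 R.
rewrite -(@Rintegral_itv_obnd_cbnd _ 0 (BRight pi)); last first.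
  apply: integrableS (@continuous_segment_integrable R G 0 pi cG) => //.
  exact: subset_itv_oc_cc.
rewrite -(@Rintegral_itvB _ G (BLeft (- pi)) (BRight pi) 0).
- by rewrite addrC subrK.
- exact: continuous_segment_integrable.
- by rewrite bnd_simp; lra.
- by rewrite bnd_simp; lra.
Qed.

(** Rotation by [pi] exchanges [cos] and [- cos]. *)
Lemma gibbs_massN (beta : R) : gibbs_mass (- beta) = gibbs_mass beta.
Proof.
rewrite !gibbs_mass_J !J_split// !shift_pi//.
rewrite addrC; congr (_ + _); apply: eq_Rintegral => x _; congr expR.
  by rewrite cosDpi mulrNN.
by rewrite cosDpi mulrN mulNr.
Qed.

(** The mean of [f^2] is [gibbs_mass (- beta) / gibbs_mass beta = 1], so the
    entropy is the mean of [f^2 ln (f^2) = - 2 beta cos * f^2].  Integrating the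
    derivative of [sin * expR (- beta cos)] over the circle turns it into
    [2 beta^2] times the integral of [sin^2 f^2], that is, twice the energy. *)
Lemma ent_expcos (beta : R) : 0 < beta ->
  exists g e, [/\ H1 beta (fun x => expR (- beta * cos x)) g, 0 < e,
    energy beta g = e%:E &
    ent beta (fun x => expR (- beta * cos x)) = (2 * e)%:E].
Proof.
move=> b0; pose f (x : R) := expR (- beta * cos x).
pose g (x : R) := - - beta * sin x * expR (- beta * cos x).
have df x : is_derive x (1 : R) f (g x) by exact: is_derive_expcos.
have csin : continuous (@sin R) by exact: continuous_sin.
have ccos : continuous (@cos R) by exact: continuous_cos.
have cg : continuous g.
  by apply: continuousM_fun => //; apply: continuousM_fun.
have cf : continuous f by exact: cexp.
have Z0 := gibbs_mass_gt0 beta.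
have Zn0 : gibbs_mass beta != 0 by rewrite gt_eqF.
have fw x : f x ^+ 2 * expR (beta * cos x) = expR (- beta * cos x).
  by rewrite /f expr2 -!expRD; congr expR; ring.
have N1 : sqnorm beta f = 1.
  rewrite /sqnorm /Rintegral (@integral_gibbs_cont R beta (fun x => f x ^+ 2)); last first.
    by move=> x; apply: cvgM; exact: cf.
  rewrite /=; under eq_Rintegral do rewrite fw.
  by rewrite -gibbs_mass_J gibbs_massN mulVf.
pose S := J (fun x => sin x ^+ 2 * expR (- beta * cos x)).
pose e := (gibbs_mass beta)^-1 * (beta ^+ 2 * S).
have cs2 : continuous (fun x : R => sin x ^+ 2) by apply: continuousM_fun.
have cS : continuous (fun x : R => sin x ^+ 2 * expR (- beta * cos x)).
  exact: continuousM_fun.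
exists g, e; split.
- exact: C1_H1.
- have S0 : expR (- beta) * pi <= S.
    have <- : J (fun x => expR (- beta) * sin x ^+ 2) = expR (- beta) * pi.
      rewrite J_Z//; congr (_ * _).
      have dS (x : R) : is_derive x (1 : R) (fun x => 2^-1 * (x - sin x * cos x)) (sin x ^+ 2).
        have d1 := is_deriveM (is_derive_sin x) (is_derive_cos x).
        have d2 := is_deriveB (is_derive_id x (1 : R)) d1.
        have d3 := is_deriveZ (2^-1 : R) d2.
        apply: (is_derive_eq d3); rewrite /GRing.scale/=.
        have := cos2Dsin2 x; rewrite !expr2 => h.
        have -> : cos x * cos x = 1 - sin x * sin x by rewrite -h; ring.
        by field.
      rewrite (RFTC2_total Npi dS cs2) sinN sinpi !mul0r; by field.
    rewrite /S; apply: le_Rintegral => //.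
    + by apply: continuous_segment_integrable; apply: continuousM_fun.
    + exact: continuous_segment_integrable.
    + move=> x _; rewrite mulrC ler_wpM2l ?sqr_ge0// ler_expR.
      by rewrite mulNr lerN2 ler_piMr ?cos_le1// ltW.
  rewrite mulr_gt0 ?invr_gt0// mulr_gt0 ?exprn_gt0//.
  by rewrite (lt_le_trans _ S0)// mulr_gt0 ?expR_gt0 ?pi_gt0.
- rewrite /energy (@integral_gibbs_cont R beta (fun x => g x ^+ 2)); last first.
    by move=> x; apply: cvgM; exact: cg.
  congr EFin; rewrite /e; congr (_ * _).
  rewrite -J_Z//; apply: eq_Rintegral => x _.
  by rewrite -(fw x) /g /f; ring.
- rewrite /ent N1.
  rewrite (eq_integral (fun x => (-2 * beta * (cos x * f x ^+ 2))%:E)); last first.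
    move=> x _; congr EFin; rewrite divr1 /f lnXn ?expR_gt0// expRK; ring.
  have cf2 : continuous (fun x => f x ^+ 2) by apply: continuousM_fun.
  have ccf : continuous (fun x => -2 * beta * (cos x * f x ^+ 2)).
    by apply: continuousM_fun => //; exact: continuousM_fun.
  rewrite (integral_gibbs_cont beta ccf).
  congr EFin; rewrite /e mulrCA; congr (_ * _).
  pose K := J (fun x => cos x * expR (- beta * cos x)).
  have cK : continuous (fun x : R => cos x * expR (- beta * cos x)).
    exact: continuousM_fun.
  have -> : J (fun x => -2 * beta * (cos x * f x ^+ 2) * expR (beta * cos x)) = -2 * beta * K.
    rewrite -J_Z//; apply: eq_Rintegral => x _.
    by rewrite -(fw x); ring.
  (* the integral over a period of the derivative of sin * expR (- beta cos) *)
  have KS : K + beta * S = 0.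
    rewrite -J_Z// -J_D//; last by apply: continuousM_fun.
    have dK (x : R) : is_derive x (1 : R) (fun x => sin x * expR (- beta * cos x))
        (cos x * expR (- beta * cos x) + beta * (sin x ^+ 2 * expR (- beta * cos x))).
      apply: (is_derive_eq (is_deriveM (is_derive_sin x) (is_derive_expcos (- beta) x))).
      by rewrite /GRing.scale/=; ring.
    rewrite (RFTC2_total Npi dK); last first.
      by apply: continuousD_fun => //; apply: continuousM_fun.
    by rewrite sinN sinpi !mul0r oppr0 mul0r subr0.
  have -> : K = - (beta * S) by move: KS => /eqP; rewrite addr_eq0 => /eqP.
  by ring.
Qed.

Let gibbs0_FTC (F P : R -> R) : (forall x, is_derive x (1 : R) P (F x)) ->
  continuous F ->
  (\int[gibbs 0]_(x in U) (F x)%:E = ((P pi - P (- pi)) / (2 * pi))%:E)%E.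
Proof.
move=> dP cF; rewrite integral_gibbs_cont//; congr EFin.
have -> : gibbs_mass (0 : R) = 2 * pi.
  rewrite gibbs_mass_J; under eq_Rintegral do rewrite mul0r expR0.
  rewrite Rintegral_cst//= lebesgue_measure_itv/= lte_fin Npi -EFinB/= mul1r; ring.
under eq_Rintegral do rewrite mul0r expR0 mulr1.
by rewrite (RFTC2_total Npi dP cF) mulrC.
Qed.

(** For [f = x + 2 pi], which stays positive on [U] and has energy [1], let [N]
    be the mean of [f^2].  As [ln y >= 1 - 1/y] at [y = f / sqrt N], the entropy
    is at least [2 N - 2 sqrt N * \int f = 2 N - 4 pi sqrt N].  This is at least
    [N - 4 pi^2 = pi^2 / 3 >= 1]. *)
Lemma ent_affine : exists (f g : R -> R), [/\ H1 0 f g,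
  energy 0 g = 1%:E & (1%:E <= ent 0 f)%E].
Proof.
have p0 := pi_gt0 R.
have p2 : 2 <= pi :> R by exact: pi_ge2.
have pn0 : pi != 0 :> R by rewrite gt_eqF.
pose f (x : R) := x + 2 * pi.
have dx (c x : R) : is_derive x (1 : R) (fun x => x + c) 1.
  have := is_deriveD (is_derive_id x (1 : R)) (is_derive_cst (c : R) x (1 : R)).
  by rewrite addr0.
have cf : continuous f by exact: is_derive_continuous (dx (2 * pi)).
exists f, (cst 1); split.
- by apply: C1_H1; exact: cst_continuous.
- have d1 (x : R) : is_derive x (1 : R) (fun x => x + 0) (cst 1 x ^+ 2).
    by rewrite expr1n; exact: dx.
  have c1 : continuous (fun x : R => cst 1 x ^+ 2 : R).
    by move=> x; rewrite /= expr1n; exact: cvg_cst.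
  rewrite /energy (gibbs0_FTC d1 c1); congr EFin.
  by move: (pi : R) pn0 => q q0; field.
have d2 (x : R) : is_derive x (1 : R) (fun x => 2^-1 * f x ^+ 2) (f x).
  have d := is_deriveZ (2^-1 : R) (is_deriveX 2 (dx (2 * pi) x)).
  by apply: (is_derive_eq d); rewrite /GRing.scale/= /f; field.
have d3 (x : R) : is_derive x (1 : R) (fun x => 3^-1 * f x ^+ 3) (f x ^+ 2).
  have d := is_deriveZ (3^-1 : R) (is_deriveX 3 (dx (2 * pi) x)).
  by apply: (is_derive_eq d); rewrite /GRing.scale/= /f; field.
have cf2 : continuous (fun x => f x ^+ 2) by apply: continuousM_fun.
pose N : R := 13 * pi ^+ 2 / 3.
have N0 : 0 < N by rewrite divr_gt0// mulr_gt0// exprn_gt0.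
have sN : sqnorm 0 f = N.
  rewrite /sqnorm /Rintegral (gibbs0_FTC d3 cf2) /= /N /f.
  by move: (pi : R) pn0 => q q0; field.
pose r := Num.sqrt N.
have r0 : 0 < r by rewrite sqrtr_gt0.
have rr : r ^+ 2 = N by rewrite sqr_sqrtr// ltW.
pose L (x : R) := 2 * f x ^+ 2 - 2 * r * f x.
have dL (x : R) : is_derive x (1 : R) (fun x => 2 * (3^-1 * f x ^+ 3) - 2 * r * (2^-1 * f x ^+ 2)) (L x).
  by apply: (is_derive_eq (is_deriveB (is_deriveZ (2 : R) (d3 x)) (is_deriveZ (2 * r) (d2 x)))).
have cL : continuous L.
  move=> x; apply: cvgB.
    by apply: cvgMl_tmp; exact: cf2.
  by apply: cvgMl_tmp; exact: cf.
apply: (@le_trans _ _ (\int[gibbs 0]_(x in U) (L x)%:E)%E).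
  rewrite (gibbs0_FTC dL cL) lee_fin.
  have -> : (2 * (3^-1 * f pi ^+ 3) - 2 * r * (2^-1 * f pi ^+ 2) -
     (2 * (3^-1 * f (- pi) ^+ 3) - 2 * r * (2^-1 * f (- pi) ^+ 2))) / (2 * pi)
     = 2 * N - 4 * pi * r.
    by rewrite /N /f; move: (pi : R) (r) pn0 => q s q0; field.
  have := sqr_ge0 (r - 2 * pi); rewrite sqrrB rr /N.
  nra.
apply: le_integral_any.
- exact: measurable_U.
- by apply/measurable_EFinP; apply: measurable_funTS; exact: continuous_measurable_fun.
- apply/measurable_EFinP; apply: measurable_funTS; apply: measurable_funM.
    exact: continuous_measurable_fun.
  apply: measurableT_comp => //; apply: measurable_funM => //.
  exact: continuous_measurable_fun.
- move=> x /U_itv/andP[x1 x2]; rewrite lee_fin sN -rr /L.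
  have fx0 : 0 < f x by rewrite /f; lra.
  have : ln (r / f x) <= r / f x - 1 by rewrite ln_le_sub1// divr_gt0.
  have -> : f x ^+ 2 / r ^+ 2 = (r / f x)^-1 ^+ 2.
    by field; rewrite !gt_eqF.
  rewrite lnXn ?invr_gt0 ?divr_gt0// lnV ?posrE ?divr_gt0// => h.
  have := ler_wpM2l (sqr_ge0 (f x)) h.
  have -> : f x ^+ 2 * (r / f x - 1) = r * f x - f x ^+ 2 by field; rewrite gt_eqF.
  rewrite -mulr_natr; lra.
Qed.

End lower.

Theorem theorem5p1 (R : realType) :
  (exists c1 c2 : R, 0 < c1 /\ c1 < c2 /\
     forall beta : R, 0 <= beta ->
       (c1%:E <= log_sobolev_const beta)%E /\
       (log_sobolev_const beta <= c2%:E)%E) /\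
  (exists c3 : R, 0 < c3 /\
     forall beta : R, 0 < beta ->
       (poincare_const beta <= (c3 / beta)%:E)%E).
Proof.
split; last first.
  exists (4 * (3 * pi) ^+ 2); split.
    by rewrite mulr_gt0// exprn_gt0// mulr_gt0// pi_gt0.
  move=> beta b0; apply: ereal_inf_lbound; exists (4 * (3 * pi) ^+ 2 / beta) => //.
  by move=> f g fg; apply: gibbs_poincare => //; exact: ltW.
pose K : R := (34 + 30 / ln 2) * hardy_const.
have K0 : 0 <= K.
  have l2 : 0 <= ln 2 :> R by rewrite ln_ge0// ler1n.
  by rewrite mulr_ge0 ?hardy_const_ge0// addr_ge0// divr_ge0.
(* adding 2 makes the upper constant larger than 1 *)
exists 1, (K + 2); split => //; split; first lra.
move=> beta b0; split; last first.
  apply: (@le_trans _ _ K%:E); last by rewrite lee_fin lerDl.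
  by apply: ereal_inf_lbound; exists K => // f g fg; exact: gibbs_log_sobolev.
apply: le_ereal_inf_tmp => _ [C hC <-]; rewrite lee_fin.
have [b00|bn0] := eqVneq beta 0.
  rewrite b00 in hC; have [f [g [fg eg ef]]] := @ent_affine R.
  have := le_trans ef (hC _ _ fg).
  by rewrite eg -EFinM lee_fin mulr1.
have bpos : 0 < beta by rewrite lt_neqAle eq_sym bn0.
have [g [e [fg e0 eg ef]]] := ent_expcos bpos.
have := hC _ _ fg; rewrite eg ef -EFinM lee_fin ler_pM2r//; lra.
Qed.
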